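(* Suppose $\mu$ is a weakly comparable self-similar measure on $\mathbb{R}$, with support $[0,1]$, that satisfies the asymptotic gap weak separation condition. Then the quasi-Assouad dimension of $\mu$ is bounded by $$\dim_{qA}\mu\leq\limsup_{n\to\infty}\frac{-\log Q_n}{n\log\lambda}<\infty,$$ and for all $x\in[0,1]$, $$\overline{\dim}_{\mathrm{loc}}\,\mu(x)=\limsup_{n\to\infty}\frac{\log P_n(\Delta_n(x))}{n\log\lambda},\qquad\underline{\dim}_{\mathrm{loc}}\,\mu(x)=\liminf_{n\to\infty}\frac{\log P_n(\Delta_n(x))}{n\log\lambda}.$$
   Context: $B(x,r)$ denotes the ball of centre $x$ and radius $r$. Self-similar measures. An iterated function system (IFS) is a finite family $\{S_j\}_{j=0}^{m-1}$ of maps $S_j(x)=r_jx+d_j$ on $\mathbb{R}$ with $0<r_j<1$, $d_j\in\mathbb{R}$. Its attractor is the unique non-empty compact set $F$ with $F=\bigcup_j S_j(F)$; here $F=[0,1]$, and the maps are labelled so that $S_0(0)=0$ and $S_{m-1}(1)=1$. Given probabilities $p_j>0$, $\sum_j p_j=1$, the associated self-similar measure $\mu$ is the unique Borel probability measure with $\mu(E)=\sum_j p_j\mu(S_j^{-1}(E))$ for all Borel sets $E$; its support is $[0,1]$. Put $\lambda=\min_j r_j$. For a finite word $w=w_1\cdots w_n$ put $S_w=S_{w_1}\circ\cdots\circ S_{w_n}$, $r_w=r_{w_1}\cdots r_{w_n}$, $p_w=p_{w_1}\cdots p_{w_n}$, $w^-=w_1\cdots w_{n-1}$. For $n\ge 1$,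 $\Lambda_n$ is the set of finite words $u$ with $r_u\leq\lambda^n$ and $r_{u^-}>\lambda^n$; $\Lambda_0$ consists of the empty word. Asymptotic gap weak separation condition (AGWSC). There is a non-increasing function $f(n)>0$ with $(\log f(n))/n\to0$ as $n\to\infty$ such that for all $n$, all $u,w\in\Lambda_n$ and each $z\in\{0,1\}$: if $S_u(z)\neq S_w(z)$ then $|S_u(z)-S_w(z)|\geq f(n)\lambda^n$. A self-similar measure satisfies the AGWSC if its underlying IFS does. Net intervals. For $n\ge1$ let $h_1<\dots<h_{s_n}$ be the elements of $\{S_u(0),S_u(1):u\in\Lambda_n\}$; the net intervals of level $n$ are $[h_j,h_{j+1}]$, $1\le j\le s_n-1$; $[0,1]$ is the unique net interval of level $0$. $\Delta_n(x)$ denotes a net interval of level $n$ containing $x$ (chosen arbitrarily if there are two). For a net interval $\Delta$ of level $n$ put $P_n(\Delta)=\sum_{u\in\Lambda_n,\,S_u[0,1]\supseteq\Delta}p_u$. For $n\geq1$ and $x\in[0,1]$ let $$Q_n(x)=\sup_{N\in\mathbb N}\frac{P_N(\Delta_N(x))}{P_{N+n}(\Delta_{N+n}(x))},$$ where $\Delta_{N+n}(x)$ is a net interval of level $N+n$ contained in $\Delta_N(x)$ and containing $x$ (with $P_{N+n}(\Delta_{N+n}(x))$ minimal if there are two choices), and let $Q_n=\sup_{x\in\operatorname{supp}\mu}Q_n(x)$. Weakly comparable. $\mu$ is weakly comparable if for each $q>1$ there is a constant $c>0$ depending on $q$ such that for all $n$ and all adjacent net intervals $\Delta_1,\Delta_2$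 of level $n$, $\frac1cq^{-n}P_n(\Delta_2)\leq P_n(\Delta_1)\leq c\,q^nP_n(\Delta_2)$. Dimensions. For $x\in\operatorname{supp}\mu$, $\overline{\dim}_{\mathrm{loc}}\,\mu(x)=\limsup_{r\to0}\frac{\log\mu(B(x,r))}{\log r}$ and $\underline{\dim}_{\mathrm{loc}}\,\mu(x)$ is defined with $\liminf$ instead. For $\delta\ge0$ let $H(\delta)$ be the infimum of all $s$ for which there exist $C_1,C_2>0$ such that for all $0<r\leq R^{1+\delta}\leq R\leq C_1$, $\sup_{x\in\operatorname{supp}\mu}\frac{\mu(B(x,R))}{\mu(B(x,r))}\leq C_2(R/r)^s$. Then $\dim_{qA}\mu=\lim_{\delta\to0}H(\delta)$. *)

(* Defs.v *)
(* Stated over an abstract R : realType (MathComp-Analysis). *)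
From HB Require Import structures.
From mathcomp Require Export all_boot all_order all_algebra.
From mathcomp Require Export all_classical all_reals all_analysis.
Export Order.TTheory GRing.Theory Num.Theory.
Export numFieldNormedType.Exports.

Set Implicit Arguments.
Unset Strict Implicit.
Unset Printing Implicit Defensive.

Local Open Scope classical_set_scope.
Local Open Scope ring_scope.

(* The index type is 'I_nmaps.+1: the m maps S_0, ..., S_{m-1} correspond to
   nmaps = m - 1, the first one being indexed by ord0 and the last by ord_max. *)
Record weighted_ifs (R : realType) := WeightedIFS {
  nmaps : nat;
  scaling : 'I_nmaps.+1 -> R;
  offset : 'I_nmaps.+1 -> R;
  weight : 'I_nmaps.+1 -> R;
  scaling_gt0 : forall j, 0 < scaling j;
  scaling_lt1 : forall j, scaling j < 1;
  weight_gt0 : forall j, 0 < weight j;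
  weight_sum1 : \sum_(j < nmaps.+1) weight j = 1 }.

Section SelfSimilar.
Context {R : realType}.
Variable W : weighted_ifs R.

Definition letter := 'I_(nmaps W).+1.

Definition smap (j : letter) (x : R) : R := scaling j * x + offset j.

Definition is_attractor (F : set R) : Prop :=
  [/\ F !=set0, compact F & F = \bigcup_(j in [set: letter]) (smap j @` F)].

Definition self_similar (mu : probability (measurableTypeR R) R) : Prop :=
  forall E : set (measurableTypeR R), measurable E ->
    (mu E = \sum_(j < (nmaps W).+1) (weight j)%:E * mu (smap j @^-1` E))%E.

(* The unit 1 of the big minimum is harmless since all the scaling factors are < 1. *)
Definition lambda : R := \big[Num.min/1]_(j < (nmaps W).+1) scaling j.

Definition smap_word (w : seq letter) (x : R) : R := foldr smap x w.
Definition scaling_word (w : seq letter) : R := \prod_(j <- w) scaling j.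
Definition weight_word (w : seq letter) : R := \prod_(j <- w) weight j.
Definition parent (w : seq letter) : seq letter := take (size w).-1 w.

Definition Lambda (n : nat) : set (seq letter) :=
  if n is 0%N then [set [::]]
  else [set w | scaling_word w <= lambda ^+ n /\ lambda ^+ n < scaling_word (parent w)].

Definition cylinder (w : seq letter) : set R := smap_word w @` `[0, 1].

Definition AGWSC : Prop :=
  exists f : R^nat,
    [/\ nonincreasing_seq f, (forall n, 0 < f n),
        ln (f n) / n%:R @[n --> \oo] --> (0 : R) &
        forall n u w z, Lambda n u -> Lambda n w -> z = 0 \/ z = 1 ->
          smap_word u z <> smap_word w z ->
          f n * lambda ^+ n <= `|smap_word u z - smap_word w z|].

Definition net_point (n : nat) (h : R) : Prop :=
  exists2 u, Lambda n u & h = smap_word u 0 \/ h = smap_word u 1.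

(* [h_j, h_(j+1)]: an interval between two consecutive elements of the finite
   set of net points. For n = 0 the only one is [0, 1]. *)
Definition net_interval (n : nat) (D : set R) : Prop :=
  exists a b, [/\ net_point n a, net_point n b, a < b,
                  (forall h, net_point n h -> ~ (a < h < b)) & D = `[a, b]%classic].

Definition adjacent (D1 D2 : set R) : Prop := D1 <> D2 /\ D1 `&` D2 !=set0.

(* The sum is over words, with S_u and S_w counted separately when u <> w.
   Lambda n is finite, so the finitely supported sum is the usual one. *)
Definition netP (n : nat) (D : set R) : R :=
  \sum_(u \in [set u | Lambda n u /\ D `<=` cylinder u]) weight_word u.

Definition weakly_comparable : Prop :=
  forall q : R, 1 < q -> exists2 c : R, 0 < c &
    forall n D1 D2, net_interval n D1 -> net_interval n D2 -> adjacent D1 D2 ->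
      c^-1 * q ^- n * netP n D2 <= netP n D1 <= c * q ^+ n * netP n D2.

(* An arbitrary selection x, n |-> Delta_n(x). *)
Definition net_choice (Delta : R -> nat -> set R) : Prop :=
  forall x n, `[0, 1]%classic x -> net_interval n (Delta x n) /\ Delta x n x.

(* D is a net interval of level k inside D0 containing x, with netP k D minimal
   among all such. *)
Definition min_subnet (k : nat) (D0 : set R) (x : R) (D : set R) : Prop :=
  let admissible D' := [/\ net_interval k D', D' `<=` D0 & D' x] in
  admissible D /\ forall D', admissible D' -> netP k D <= netP k D'.

Definition Qpt (Delta : R -> nat -> set R) (n : nat) (x : R) : \bar R :=
  ereal_sup [set y | exists N D, min_subnet (N + n) (Delta x N) x D /\
                       y = (netP N (Delta x N) / netP (N + n) D)%:E].

End SelfSimilar.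

Section Dimensions.
Context {R : realType}.
Variable mu : probability (measurableTypeR R) R.

Definition msupport : set R :=
  [set x | forall r : R, 0 < r -> (0 < mu (ball x r))%E].

Definition Qsup (W : weighted_ifs R) (Delta : R -> nat -> set R) (n : nat) : \bar R :=
  ereal_sup [set Qpt W Delta n x | x in msupport].

Definition upper_dim_loc (x : R) : \bar R :=
  limf_esup (fun r : R => lne (mu (ball x r)) / (ln r)%:E)%E 0^'+.

Definition lower_dim_loc (x : R) : \bar R :=
  limf_einf (fun r : R => lne (mu (ball x r)) / (ln r)%:E)%E 0^'+.

Definition qA_admissible (delta s : R) : Prop :=
  exists C1 C2 : R, [/\ 0 < C1, 0 < C2 &
    forall r rho : R, 0 < r -> r <= rho `^ (1 + delta) ->
      rho `^ (1 + delta) <= rho -> rho <= C1 ->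
      (ereal_sup [set mu (ball x rho) / mu (ball x r) | x in msupport]
         <= (C2 * (rho / r) `^ s)%:E)%E].

Definition qA_exponent (delta : R) : \bar R :=
  ereal_inf [set s%:E | s in qA_admissible delta].

Definition dim_qA : \bar R := lim (qA_exponent delta @[delta --> 0^'+]).

(* The limit defining dim_qA always exists, by monotonicity. *)
Lemma qA_exponent_nonincreasing (d1 d2 : R) : 0 < d1 -> d1 <= d2 ->
  (qA_exponent d2 <= qA_exponent d1)%E.
Proof.
move=> d1_gt0 d12; apply: le_ereal_inf_tmp => _ /= [s [C1 [C2 [C1_gt0 C2_gt0 hs]]] <-].
apply: ereal_inf_lbound; exists s => //.
exists C1, C2; split=> // r rho r_gt0 r_le rho_le rhoC.
have rho_gt0 : 0 < rho.
  by rewrite (lt_le_trans _ rho_le)// (lt_le_trans r_gt0).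
have rho_le1 : rho <= 1.
  rewrite leNgt; apply/negP => rho_gt1; move: rho_le.
  rewrite -[leRHS](powRr1 (ltW rho_gt0)) leNgt => /negP; apply.
  rewrite /powR gt_eqF// ltr_expR ltr_pM2r ?ln_gt0//.
  by rewrite ltrDl (lt_le_trans d1_gt0).
have mono a b : a <= b -> rho `^ b <= rho `^ a.
  by apply: ger_powR; rewrite rho_gt0.
apply: hs => //.
- by apply: (le_trans r_le); apply: mono; rewrite lerD2l.
- by rewrite -[leRHS](powRr1 (ltW rho_gt0)); apply: mono; rewrite lerDl ltW.
Qed.

Lemma qA_exponent_cvg : cvg (qA_exponent delta @[delta --> 0^'+]).
Proof.
apply: nonincreasing_at_right_is_cvge; near=> e => x y.
rewrite !in_itv/= => /andP[x0 _] _ xy.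
exact: qA_exponent_nonincreasing.
Unshelve. all: by end_near. Qed.

End Dimensions.

(* Main.v *)
(* The set Lambda n is a cut of the tree of words, so mu = sum_u p_u mu(S_u^-1 _)
   over Lambda n. If D is a net interval of level n containing x, then the ball
   B(x, 2 lambda^n) contains every cylinder covering D, hence has measure at
   least P_n(D). Conversely, by the AGWSC an open ball of diameter at most
   f(n) lambda^n contains at most one left endpoint S_u(0) and at most one right
   endpoint S_u(1), hence at most two net points, although a left and a right
   endpoint may be arbitrarily close and net intervals arbitrarily short. The
   cylinders meeting B(x, f(n) lambda^n / 2) therefore cover D or one of its four
   nearest neighbours, and weak comparability bounds the measure of that ball by
   C q^n P_n(D). Both radii have logarithm n log(lambda) (1 + o(1)), which yields
   the local dimensions. For the quasi-Assouad dimension, the levels N and N + n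
   attached to R and to r <= R^(1 + delta) satisfy n >= c N, so that the factor
   q^N and the subexponential errors are absorbed by an arbitrarily small power
   of R / r, while P_N / P_(N+n) is at most Q_n. *)
Require Import Defs.
From mathcomp Require Import measurable_realfun lra zify.

Set Implicit Arguments.
Unset Strict Implicit.
Unset Printing Implicit Defensive.

Local Open Scope classical_set_scope.
Local Open Scope ring_scope.

(** * Words and cuts of the word tree *)

Lemma exists_expr_lt (R : realType) (x t : R) :
  0 <= x -> x < 1 -> 0 < t -> exists k, x ^+ k < t.
Proof.
move=> x0 x1 t0.
have h : x ^+ n @[n --> \oo] --> 0 by apply: cvg_expr; rewrite ger0_norm.
have [k _ kP] : \forall n \near \oo, x ^+ n < t by exact: (cvgr_lt _ h).
by exists k; apply: kP => /=.
Qed.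

Lemma uniq_flatten_map (S T : eqType) (s : seq S) (f : S -> seq T) :
  uniq s -> (forall x, uniq (f x)) ->
  (forall x y v, v \in f x -> v \in f y -> x = y) ->
  uniq (flatten [seq f x | x <- s]).
Proof.
move=> us uf fd; elim: s us => //= x s IH /andP[xs us].
rewrite cat_uniq uf IH// andbT /=; apply/hasPn => v /flattenP[_ /mapP[y ys ->] vy].
by apply/negP => vx; rewrite (fd _ _ _ vx vy) ys in xs.
Qed.

Lemma exists_seq_argmin (R : realDomainType) (T : eqType) (s : seq T) (P : T -> Prop)
    (F : T -> R) :
  (exists2 x, x \in s & P x) ->
  exists x, [/\ x \in s, P x & forall y, y \in s -> P y -> F x <= F y].
Proof.
elim: s => [[//]|a s IH [x]].
have [[z zs Pz] _ _|none] := pselect (exists2 z, z \in s & P z).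
  have [y [ys Py ymin]] := IH (ex_intro2 _ _ z zs Pz).
  have [Pa|nPa] := pselect (P a); last first.
    exists y; split; rewrite ?inE ?ys ?orbT// => w; rewrite inE.
    by case/predU1P => [-> //|]; apply: ymin.
  have [ay|ya] := leP (F a) (F y).
    exists a; split; rewrite ?inE ?eqxx// => w; rewrite inE.
    case/predU1P => [-> //|ws Pw]; apply: (le_trans ay); exact: ymin.
  exists y; split; rewrite ?inE ?ys ?orbT// => w; rewrite inE.
  by case/predU1P => [-> _|]; [exact: ltW|apply: ymin].
rewrite inE => /predU1P[-> Pa|xs Px]; last by case: none; exists x.
exists a; split; rewrite ?inE ?eqxx// => w; rewrite inE.
by case/predU1P => [-> //|ws Pw]; case: none; exists w.
Qed.

Section Words.
Context {R : realType} (W : weighted_ifs R).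
Implicit Types (u v w : seq (letter W)) (t : R).

Lemma lambda_le_scaling (j : letter W) : lambda W <= scaling j.
Proof. exact: bigmin_le. Qed.

Lemma lambda_gt0 : 0 < lambda W.
Proof. by apply: lt_bigmin => // j _; exact: scaling_gt0. Qed.

Lemma lambda_lt1 : lambda W < 1.
Proof. exact: le_lt_trans (lambda_le_scaling ord0) (scaling_lt1 _). Qed.

Lemma lambdaX_gt0 n : 0 < lambda W ^+ n.
Proof. by rewrite exprn_gt0// lambda_gt0. Qed.

Lemma lambdaX_le1 n : lambda W ^+ n <= 1.
Proof. by rewrite exprn_ile1 ?(ltW lambda_gt0) ?(ltW lambda_lt1). Qed.

Lemma exists_scaling_bound :
  exists rho : R, [/\ 0 < rho, rho < 1 & forall j : letter W, scaling j <= rho].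
Proof.
exists (\big[Num.max/0]_(j < (nmaps W).+1) scaling j); split.
- apply: (lt_le_trans (scaling_gt0 (ord0 : letter W))); exact: le_bigmax.
- by apply: bigmax_lt => // j _; exact: scaling_lt1.
- by move=> j; exact: le_bigmax.
Qed.

Lemma exists_weight_bound :
  exists p : R, [/\ 0 < p, p <= 1 & forall j : letter W, p <= weight j].
Proof.
exists (\big[Num.min/1]_(j < (nmaps W).+1) weight j); split.
- by apply: lt_bigmin => // j _; exact: weight_gt0.
- exact: bigmin_le_id.
- by move=> j; exact: bigmin_le.
Qed.

Lemma scaling_word_gt0 w : 0 < scaling_word w.
Proof. by apply: prodr_gt0 => j _; exact: scaling_gt0. Qed.

Lemma weight_word_gt0 w : 0 < weight_word w.
Proof. by apply: prodr_gt0 => j _; exact: weight_gt0. Qed.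

Lemma scaling_word_cat u v : scaling_word (u ++ v) = scaling_word u * scaling_word v.
Proof. by rewrite /scaling_word big_cat. Qed.

Lemma weight_word_cat u v : weight_word (u ++ v) = weight_word u * weight_word v.
Proof. by rewrite /weight_word big_cat. Qed.

Lemma scaling_word_le_exp (rho : R) w : (forall j : letter W, scaling j <= rho) ->
  scaling_word w <= rho ^+ size w.
Proof.
move=> hrho; rewrite /scaling_word; elim: w => [|j w IH]; first by rewrite big_nil.
rewrite big_cons /= exprS ler_pM// ?(ltW (scaling_gt0 _))//.
by rewrite (ltW (scaling_word_gt0 _)).
Qed.

Lemma weight_word_ge_exp (p : R) w : 0 <= p -> (forall j : letter W, p <= weight j) ->
  p ^+ size w <= weight_word w.
Proof.
move=> p0 hp; rewrite /weight_word; elim: w => [|j w IH]; first by rewrite big_nil.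
by rewrite big_cons /= exprS ler_pM// exprn_ge0.
Qed.

Lemma scaling_word_le1 w : scaling_word w <= 1.
Proof.
rewrite (le_trans (scaling_word_le_exp w (rho := 1) _)) ?expr1n// => j.
exact: ltW (scaling_lt1 _).
Qed.

Lemma scaling_word_cat_le u v : scaling_word (u ++ v) <= scaling_word u.
Proof.
by rewrite scaling_word_cat ler_piMr ?scaling_word_le1// ltW// scaling_word_gt0.
Qed.

Lemma parent_rcons w (j : letter W) : parent (rcons w j) = w.
Proof. by rewrite /parent size_rcons /= -cats1 take_size_cat. Qed.

Lemma smap_word_cat u v x : smap_word (u ++ v) x = smap_word u (smap_word v x).
Proof. by rewrite /smap_word foldr_cat. Qed.

Lemma smap_word_rcons w (j : letter W) x : smap_word (rcons w j) x = smap_word w (smap j x).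
Proof. by rewrite -cats1 smap_word_cat. Qed.

Lemma smap_wordE w x : smap_word w x = scaling_word w * x + smap_word w 0.
Proof.
elim: w => [|j w IH] /=; first by rewrite /scaling_word big_nil; lra.
rewrite IH /smap /scaling_word big_cons; lra.
Qed.

Lemma smap_word1E w : smap_word w 1 = smap_word w 0 + scaling_word w.
Proof. by rewrite smap_wordE mulr1 addrC. Qed.

Lemma smap_word_lt01 w : smap_word w 0 < smap_word w 1.
Proof. by rewrite smap_word1E ltrDl scaling_word_gt0. Qed.

Lemma cylinderP w x : cylinder w x <-> smap_word w 0 <= x <= smap_word w 1.
Proof.
have w0 := scaling_word_gt0 w; rewrite smap_word1E; split.
  move=> [y /=]; rewrite in_itv /= => /andP[y0 y1] <-; rewrite (smap_wordE w y); apply/andP; split.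
    by rewrite lerDr mulr_ge0// ltW.
  by rewrite addrC lerD2l ler_piMr// ltW.
move=> /andP[x0 x1]; exists ((x - smap_word w 0) / scaling_word w) => /=.
  rewrite in_itv /= divr_ge0 ?subr_ge0// ?(ltW w0)//= ler_pdivrMr// mul1r.
  by rewrite lerBlDr addrC.
by rewrite smap_wordE mulrC divfK ?gt_eqF// subrK.
Qed.

(** One description for all levels: the empty word is its own [parent], so level 0 needs the extra
    disjunct, while at positive levels [lambda ^+ n < 1] rules the empty word out. *)
Lemma LambdaP n w : Lambda n w <->
  scaling_word w <= lambda W ^+ n /\ (w = [::] \/ lambda W ^+ n < scaling_word (parent w)).
Proof.
case: n => [|n] /=.
  rewrite expr0; split=> [->|[_ [//|]]].
    by rewrite scaling_word_le1; split=> //; left.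
  by move=> h; have := scaling_word_le1 (parent w); rewrite leNgt h.
split=> [[]|[h [w0|]]]; [by split => //; right| |by []].
rewrite {}w0 in h *; split => //; rewrite /scaling_word big_nil in h.
have := exprn_ilt1 n.+1 (ltW lambda_gt0) lambda_lt1.
by rewrite ltNge h.
Qed.

(* The fuel [k] bounds the number of letters appended to [w]. *)
Fixpoint cut_words t (k : nat) w : seq (seq (letter W)) :=
  if scaling_word w <= t then [:: w] else
  if k is k'.+1 then flatten [seq cut_words t k' (rcons w j) | j <- enum 'I_(nmaps W).+1]
  else [:: w].

Lemma cut_words_prefix t k w v : v \in cut_words t k w -> exists s, v = w ++ s.
Proof.
elim: k w => [|k IH] w /=; first by rewrite if_same inE => /eqP ->; exists [::]; rewrite cats0.
case: ifP => _; first by rewrite inE => /eqP ->; exists [::]; rewrite cats0.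
by case/flattenP => _ /mapP[j _ ->] /IH[s ->]; exists (j :: s); rewrite cat_rcons.
Qed.

Lemma cut_words_uniq t k w : uniq (cut_words t k w).
Proof.
elim: k w => [|k IH] w /=; first by rewrite if_same.
case: ifP => // _; apply: uniq_flatten_map => //; first exact: enum_uniq.
move=> i j v /cut_words_prefix[s ->] /cut_words_prefix[s'].
by rewrite !cat_rcons => /(congr1 (drop (size w))); rewrite !drop_size_cat// => -[].
Qed.

Lemma cut_words_sum (V : nmodType) (F : seq (letter W) -> V) t k w :
  (forall u, F u = \sum_(j < (nmaps W).+1) F (rcons u j)) ->
  F w = \sum_(v <- cut_words t k w) F v.
Proof.
move=> FE; elim: k w => [|k IH] w /=; first by rewrite if_same big_seq1.
case: ifP => _; first by rewrite big_seq1.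
rewrite big_flatten /= big_map FE big_enum /=; exact: eq_bigr.
Qed.

(** The bound on [scaling_word w * rho ^+ k] says that the fuel suffices: after [k] more letters
    every ratio is at most [t], so the recursion never stops too early. *)
Lemma cut_words_sub rho t k w v : 0 <= rho -> (forall j : letter W, scaling j <= rho) ->
  scaling_word w * rho ^+ k <= t ->
  v \in cut_words t k w ->
  scaling_word v <= t /\ (v = w \/ t < scaling_word (parent v)).
Proof.
move=> rho0 hrho; elim: k w => [|k IH] w /= wt.
  by rewrite if_same inE => /eqP ->; rewrite expr0 mulr1 in wt; split => //; left.
case: ifP => [h|/negbT]; first by rewrite inE => /eqP ->; split => //; left.
rewrite -ltNge => tw /flattenP[_ /mapP[j _ ->]] vj.
have [|vt [vE|]] := IH (rcons w j) _ vj; last by split => //; right.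
  apply: le_trans wt; rewrite -cats1 scaling_word_cat exprS mulrA ler_wpM2r ?exprn_ge0//.
  by rewrite ler_wpM2l ?(ltW (scaling_word_gt0 _))// /scaling_word big_seq1.
by split => //; right; rewrite vE parent_rcons.
Qed.

Lemma mem_cut_words t k w s : (size s <= k)%N ->
  scaling_word (w ++ s) <= t -> s = [::] \/ t < scaling_word (parent (w ++ s)) ->
  w ++ s \in cut_words t k w.
Proof.
elim: k w s => [|k IH] w [|j s] //= sk wst.
- by rewrite cats0 if_same inE.
- by rewrite !cats0 in wst * => _; rewrite wst inE.
case=> // tws; case: ifP => [wt|_].
  (* Stopping at [w] is impossible: the parent of [w ++ j :: s] still extends [w], so its ratio
     would be at most [t] as well. *)
  move: tws; rewrite /parent size_cat /= addnS /= take_cat ltnNge leq_addr /= => tws.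
  by have := lt_le_trans tws (le_trans (scaling_word_cat_le _ _) wt); rewrite ltxx.
apply/flattenP; exists (cut_words t k (rcons w j)).
  by apply: map_f; rewrite mem_enum.
rewrite -cat_rcons; apply: IH => //; first by rewrite cat_rcons.
by case: s {sk wst} tws => [|i s] tws; [left|right; rewrite cat_rcons].
Qed.

(* The last clause applies to any quantity that splits over the children of a
   word, such as [w |-> p_w mu(S_w^-1 E)]. *)
Lemma Lambda_enum n : exists s : seq (seq (letter W)),
  [/\ uniq s, forall w, Lambda n w <-> w \in s &
   forall (V : nmodType) (F : seq (letter W) -> V),
     (forall u, F u = \sum_(j < (nmaps W).+1) F (rcons u j)) ->
     F [::] = \sum_(w <- s) F w].
Proof.
have [rho [rho0 rho1 hrho]] := exists_scaling_bound.
have [k hk] := exists_expr_lt (ltW rho0) rho1 (lambdaX_gt0 n).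
(* A word of more than [k] letters has a parent of ratio at most [rho ^+ k < lambda ^+ n], so this
   fuel reaches all of [Lambda n]. *)
exists (cut_words (lambda W ^+ n) k.+1 [::]); split; first exact: cut_words_uniq.
  move=> w; split=> [/LambdaP[h1 h2]|wcut].
    apply: (@mem_cut_words _ _ [::]) => //.
    case: h2 => [->//|h2]; have := lt_le_trans h2 (scaling_word_le_exp _ hrho).
    move=> /(lt_trans hk); rewrite ltr_iXn2l// size_take_min; lia.
  apply/LambdaP; apply: (cut_words_sub (ltW rho0) hrho _ wcut).
  rewrite /scaling_word big_nil mul1r exprS; apply: (le_trans _ (ltW hk)).
  by rewrite ler_piMl ?exprn_ge0// ltW.
by move=> V F FE; exact: cut_words_sum.
Qed.

End Words.

Lemma ler_sum_subset (R : realDomainType) (T : eqType) (s t : seq T) (F : T -> R) :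
  uniq s -> uniq t -> {subset s <= t} -> (forall x, 0 <= F x) ->
  \sum_(x <- s) F x <= \sum_(x <- t) F x.
Proof.
move=> us ut st F0; have -> : \sum_(x <- s) F x = \sum_(x <- t | x \in s) F x.
  rewrite -[RHS]big_filter; apply: perm_big; apply: uniq_perm => //; first exact: filter_uniq.
  by move=> x; rewrite mem_filter; case: (boolP (x \in s)) => // /st ->.
by rewrite big_mkcond; apply: ler_sum => x _; case: ifP.
Qed.

(** * Extending words from one level to a later one *)

Section Net.
Context {R : realType} (W : weighted_ifs R).
Hypothesis W_attractor : is_attractor W `[0, 1].
Hypothesis W_first : smap (W := W) ord0 0 = 0.
Hypothesis W_last : smap (W := W) ord_max 1 = 1.
Implicit Types (u v w : seq (letter W)) (t a b h x y : R) (D : set R).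

Lemma smap_itv01 (j : letter W) x : 0 <= x <= 1 -> 0 <= smap j x <= 1.
Proof.
case: W_attractor => _ _ E x01.
have : (\bigcup_(j in [set: letter W]) (smap j @` `[0, 1])) (smap j x).
  by exists j => //; exists x => //=; rewrite in_itv.
by rewrite -E /= in_itv.
Qed.

Lemma smap_word_itv01 u x : 0 <= x <= 1 -> 0 <= smap_word u x <= 1.
Proof. by move=> x01; elim: u => //= j u IH; exact: smap_itv01. Qed.

Lemma itv01_smap x : 0 <= x <= 1 -> exists (j : letter W) y, 0 <= y <= 1 /\ x = smap j y.
Proof.
case: W_attractor => _ _ E x01.
have : `[0, 1]%classic x by rewrite /= in_itv.
rewrite E => -[j _ [y /=]]; rewrite in_itv /= => y01 <-.
by exists j, y.
Qed.

(** [I] is a property that a word hands on to at least one child, such as having a given point in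
    its cylinder or a given endpoint. Such letters are appended until the ratio first drops to
    [t]. *)
Lemma extend_until t u (I : seq (letter W) -> Prop) : 0 < t ->
  (forall w, I w -> exists j, I (rcons w j)) -> I u ->
  exists v, [/\ I (u ++ v), scaling_word (u ++ v) <= t &
                v = [::] \/ t < scaling_word (parent (u ++ v))].
Proof.
move=> t0 Istep.
have [rho [rho0 rho1 hrho]] := exists_scaling_bound W.
have [k hk] := exists_expr_lt (ltW rho0) rho1 t0.
have {hk} : scaling_word u * rho ^+ k <= t.
  by rewrite (le_trans _ (ltW hk))// ler_piMl ?exprn_ge0 ?scaling_word_le1// ltW.
elim: k u => [|k IH] u ut Iu.
  by exists [::]; rewrite cats0; split => //; [rewrite expr0 mulr1 in ut|left].
have [h|h] := leP (scaling_word u) t.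
  by exists [::]; rewrite cats0; split => //; left.
have [j Ij] := Istep _ Iu; have [|v [Iv vt vs]] := IH (rcons u j) _ Ij.
  apply: le_trans ut; rewrite -cats1 scaling_word_cat exprS mulrA ler_wpM2r ?exprn_ge0 ?(ltW rho0)//.
  by rewrite ler_pM2l ?scaling_word_gt0// /scaling_word big_seq1.
exists (j :: v); rewrite -cat_rcons; split => //; right.
by case: vs => [->|//]; rewrite cats0 parent_rcons.
Qed.

(** The last clause bounds the length of [v] in terms of [n] alone: the parent of [u ++ v] has ratio
    above [lambda ^+ (N + n)], of which [u] accounts for a factor at most [lambda ^+ N]. *)
Lemma Lambda_extend N n u (I : seq (letter W) -> Prop) : Lambda N u ->
  (forall w, I w -> exists j, I (rcons w j)) -> I u ->
  exists v, [/\ Lambda (N + n) (u ++ v), I (u ++ v) &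
                v = [::] \/ lambda W ^+ n < scaling_word (parent v)].
Proof.
move=> /LambdaP[u1 u2] Istep Iu.
have [v [Iv vt vs]] := extend_until (lambdaX_gt0 W (N + n)) Istep Iu.
have par : v <> [::] -> parent (u ++ v) = u ++ parent v.
  by case/lastP: v {Iv vt vs} => // v j _; rewrite -rcons_cat !parent_rcons.
exists v; split => //.
  apply/LambdaP; split => //; case: vs => [->|vs]; last by right.
  rewrite cats0; case: u2 => [->|u2]; [by left|right].
  apply: le_lt_trans u2; rewrite exprD ler_piMr ?lambdaX_le1//.
  exact: ltW (lambdaX_gt0 _ _).
have [->|vn] := pselect (v = [::]); [by left|right].
case: vs => // ; rewrite (par vn) scaling_word_cat exprD => vs.
have := lt_le_trans vs (ler_wpM2r (ltW (scaling_word_gt0 _)) u1).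
by rewrite ltr_pM2l ?lambdaX_gt0.
Qed.

(** Prefixes of one word are comparable; were [u] a proper prefix of [u'], the parent of [u'] would
    extend [u] and already have ratio at most [lambda ^+ N]. *)
Lemma Lambda_antichain N u u' v v' :
  Lambda N u -> Lambda N u' -> u ++ v = u' ++ v' -> u = u'.
Proof.
wlog le_uu' : u u' v v' / (size u <= size u')%N.
  by case/orP: (leq_total (size u) (size u')) => h H *; [|apply: esym]; apply: H h _ _ _; eauto.
move=> /LambdaP[u1 _] /LambdaP[u1' u2'] E.
have uE : u' = u ++ drop (size u) u'.
  have := congr1 (take (size u)) E; rewrite take_size_cat// takel_cat// => uE.
  by rewrite {1}uE cat_take_drop.
case/lastP: (drop _ u') uE => [->|s j uE]; first by rewrite cats0.
have : parent u' = u ++ s by rewrite uE -rcons_cat parent_rcons.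
case: u2' => [u0|u2' p]; first by move: uE; rewrite u0; case: (u) => //; case: (s).
rewrite p in u2'; have := lt_le_trans u2' (scaling_word_cat_le _ _).
by rewrite ltNge u1.
Qed.

Lemma cylinder_step y w : cylinder w y -> exists j : letter W, cylinder (rcons w j) y.
Proof.
move=> [x /=]; rewrite in_itv /= => /itv01_smap[j [z [z01 ->]]] <-.
by exists j; exists z; [rewrite /= in_itv|rewrite smap_word_rcons].
Qed.

Lemma Lambda_cylinder n x : 0 <= x <= 1 -> exists2 u, Lambda (W := W) n u & cylinder u x.
Proof.
move=> x01; have L0 : Lambda (W := W) 0 [::] by [].
have [|v [vL vc _]] := @Lambda_extend 0 n _ (fun w => cylinder w x) L0 (@cylinder_step x).
  by apply/cylinderP.
by exists v.
Qed.

(** The first map fixes 0 and the last fixes 1, so appending these letters keeps the left,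
    respectively the right, endpoint of a cylinder. *)
Lemma net_point_refine N n h : net_point W N h -> net_point W (N + n) h.
Proof.
move=> [u uL [->|->]].
  have [w wE||v [vL <- _]] := @Lambda_extend N n u (fun w => smap_word w 0 = smap_word u 0) uL.
  - by exists ord0; rewrite smap_word_rcons W_first.
  - by [].
  - by exists (u ++ v) => //; left.
have [w wE||v [vL <- _]] := @Lambda_extend N n u (fun w => smap_word w 1 = smap_word u 1) uL.
- by exists ord_max; rewrite smap_word_rcons W_last.
- by [].
- by exists (u ++ v) => //; right.
Qed.

End Net.

(** * Net intervals *)

Section Net.
Context {R : realType} (W : weighted_ifs R).
Hypothesis W_attractor : is_attractor W `[0, 1].
Hypothesis W_first : smap (W := W) ord0 0 = 0.
Hypothesis W_last : smap (W := W) ord_max 1 = 1.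
Implicit Types (u v w : seq (letter W)) (t a b h x y : R) (D : set R).

Definition net_pair (n : nat) a b :=
  [/\ net_point W n a, net_point W n b, a < b & forall h, net_point W n h -> ~ (a < h < b)].

Lemma net_intervalP n D : net_interval W n D <-> exists a b, net_pair n a b /\ D = `[a, b]%classic.
Proof.
by split=> [[a [b [p1 p2 p3 p4 p5]]]|[a [b [[p1 p2 p3 p4] p5]]]]; exists a, b; split.
Qed.

Lemma net_pair_interval n a b : net_pair n a b -> net_interval W n `[a, b].
Proof. by move=> ?; apply/net_intervalP; exists a, b. Qed.

Lemma net_point_enum n : exists s : seq R, forall h, net_point W n h <-> h \in s.
Proof.
have [s [us sP _]] := Lambda_enum W n.
exists ([seq smap_word u 0 | u <- s] ++ [seq smap_word u 1 | u <- s]) => h.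
rewrite mem_cat; split=> [[u /sP us' [->|->]]|].
- by apply/orP; left; apply: (map_f (fun u => smap_word u 0)).
- by apply/orP; right; apply: (map_f (fun u => smap_word u 1)).
by case/orP => /mapP[u /sP uL ->]; exists u => //; [left|right].
Qed.

Lemma net_point_itv01 n h : net_point W n h -> 0 <= h <= 1.
Proof.
by move=> [u _ [->|->]]; apply: smap_word_itv01 => //; rewrite lexx ler01.
Qed.

Lemma next_net_point n (P : R -> Prop) b : net_point W n b -> P b ->
  exists b', [/\ net_point W n b', P b', b' <= b & forall h, net_point W n h -> P h -> b' <= h].
Proof.
move=> /[dup] nb; have [s sP] := net_point_enum n; move=> /sP bs Pb.
have [b' [b's Pb' b'min]] := @exists_seq_argmin _ _ s P id (ex_intro2 _ _ b bs Pb).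
by exists b'; split; [exact/sP|by []|exact: b'min|by move=> h /sP; exact: b'min].
Qed.

Lemma prev_net_point n (P : R -> Prop) a : net_point W n a -> P a ->
  exists a', [/\ net_point W n a', P a', a <= a' & forall h, net_point W n h -> P h -> h <= a'].
Proof.
move=> /[dup] na; have [s sP] := net_point_enum n; move=> /sP as_ Pa.
have [a' [a's Pa' a'max]] := @exists_seq_argmin _ _ s P -%R (ex_intro2 _ _ a as_ Pa).
exists a'; split => //; [exact/sP|by rewrite -lerN2; exact: a'max|].
by move=> h /sP hs Ph; rewrite -lerN2; exact: a'max.
Qed.

Lemma net_pair_right n a b : net_point W n a -> net_point W n b -> a < b ->
  exists2 b', net_pair n a b' & b' <= b.
Proof.
move=> na nb ab; have [b' [nb' ab' b'b bmin]] := @next_net_point n (fun h => a < h) b nb ab.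
exists b' => //; split => // h nh /andP[ah hb'].
by have := bmin h nh ah; rewrite leNgt hb'.
Qed.

Lemma net_pair_left n a b : net_point W n a -> net_point W n b -> a < b ->
  exists2 a', net_pair n a' b & a <= a'.
Proof.
move=> na nb ab; have [a' [na' ab' aa' amax]] := @prev_net_point n (fun h => h < b) a na ab.
exists a' => //; split => // h nh /andP[ah hb].
by have := amax h nh hb; rewrite leNgt ah.
Qed.

Lemma net_pair_sep n a b h : net_pair n a b -> net_point W n h -> h <= a \/ b <= h.
Proof.
move=> [_ _ ab nab] nh; have [|ah] := leP h a; first by left.
have [|hb] := leP b h; first by right.
by case: (nab _ nh); rewrite ah hb.
Qed.

(** The endpoints of the cylinder are net points of the same level, so none lies strictly between
    [a] and [b]; a cylinder that meets the open interval covers it. *)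
Lemma net_pair_cylinder n a b u : net_pair n a b -> Lambda n u ->
  smap_word u 0 < b -> a < smap_word u 1 -> `[a, b] `<=` cylinder u.
Proof.
move=> nab uL ub au x /=; rewrite in_itv /= => /andP[ax xb]; apply/cylinderP.
have [||] := @net_pair_sep n a b (smap_word u 0) nab.
- by exists u => //; left.
- move=> ua; have [||] := @net_pair_sep n a b (smap_word u 1) nab.
  + by exists u => //; right.
  + by rewrite leNgt au.
  + by move=> bu; rewrite (le_trans ua)// (le_trans xb).
- by rewrite leNgt ub.
Qed.

Lemma min_subnet_exists N n a b x : net_pair N a b -> a <= x <= b ->
  exists D, min_subnet W (N + n) `[a, b] x D.
Proof.
move=> [na nb ab _] /andP[ax xb].
have na' := @net_point_refine _ W W_first W_last N n a na.
have nb' := @net_point_refine _ W W_first W_last N n b nb.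
have [c [d [ncd ac db /andP[cx xd]]]] : exists c d,
    [/\ net_pair (N + n) c d, a <= c, d <= b & c <= x <= d].
  (* The interval starting at the last net point not beyond [x] stays inside [[a, b]], except when
     [x = b]; then the one ending at [b] serves. *)
  have [xb'|bx] := ltP x b.
    have [c [nc cx ac cmax]] := @prev_net_point _ (fun h => h <= x) _ na' ax.
    have [d ncd db] := net_pair_right nc nb' (le_lt_trans cx xb').
    exists c, d; split => //; rewrite cx /= leNgt; apply/negP => dx.
    by case: ncd => _ nd cd _; have := cmax d nd (ltW dx); rewrite leNgt cd.
  have [c ncb ac] := net_pair_left na' nb' ab.
  by exists c, b; split => //; case: ncb => _ _ cb _; rewrite xb (le_trans (ltW cb)).
(* Admissible intervals have both endpoints in the finite list [s], so the minimum of [netP] is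
   attained. *)
have [s sP] := net_point_enum (N + n).
pose adm (p : R * R) := [/\ net_interval W (N + n) `[p.1, p.2],
  `[p.1, p.2] `<=` `[a, b] & `[p.1, p.2]%classic x].
have [|p [_ [p1 p2 p3] pmin]] := @exists_seq_argmin _ _ [seq (y, z) | y <- s, z <- s] adm
   (fun p => netP W (N + n) `[p.1, p.2]).
  exists (c, d); first by case: ncd => /sP cs /sP ds _ _; exact: allpairs_f.
  split=> /=; first exact: net_pair_interval.
    by move=> z /=; rewrite !in_itv /= => /andP[cz zd]; rewrite (le_trans ac)//= (le_trans zd).
  by rewrite in_itv /= cx xd.
exists `[p.1, p.2]%classic; split => // _ [/net_intervalP[y [z [nyz ->]]] Dab Dx].
apply: (pmin (y, z)); first by case: nyz => /sP ys /sP zs _ _; exact: allpairs_f.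
by split => //; exact: net_pair_interval.
Qed.

Lemma net_pair_level0 a b : net_pair 0 a b -> a = 0 /\ b = 1.
Proof.
have n0 h : net_point W 0 h -> h = 0 \/ h = 1 by move=> [u /= -> [] ->]; [left|right].
move=> [/n0[]-> /n0[]-> ab _] //; move: ab; rewrite ?ltxx//.
by rewrite ltNge ler01.
Qed.

Lemma netP_enum n : exists s : seq (seq (letter W)),
  [/\ uniq s, forall w, Lambda n w <-> w \in s,
   forall D, netP W n D = \sum_(w <- s | `[< D `<=` cylinder w >]) weight_word w &
   forall (V : nmodType) (F : seq (letter W) -> V),
     (forall u, F u = \sum_(j < (nmaps W).+1) F (rcons u j)) ->
     F [::] = \sum_(w <- s) F w].
Proof.
have [s [us sP sF]] := Lambda_enum W n; exists s; split => // D.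
rewrite -big_filter fsbig_seq ?filter_uniq// /netP; apply: eq_fsbigl.
apply/seteqP; split=> u /=; rewrite mem_filter.
  by move=> [/sP -> /asboolP ->].
by move=> /andP[/asboolP ? /sP].
Qed.

Lemma weight_wordE u : weight_word u = \sum_(j < (nmaps W).+1) weight_word (rcons u j).
Proof.
under eq_bigr do rewrite -cats1 weight_word_cat.
rewrite -mulr_sumr -[LHS]mulr1; congr (_ * _).
by rewrite -(weight_sum1 W); apply: eq_bigr => j _; rewrite /weight_word big_seq1.
Qed.

Lemma netP_le1 n D : netP W n D <= 1.
Proof.
have [s [_ _ -> /(_ _ _ weight_wordE) h]] := netP_enum n.
have -> : 1 = weight_word ([::] : seq (letter W)) by rewrite /weight_word big_nil.
rewrite h big_mkcond /=.
by apply: ler_sum => w _; case: ifP => // _; apply: ltW; exact: weight_word_gt0.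
Qed.

Lemma netP_ge0 n D : 0 <= netP W n D.
Proof.
have [s [_ _ -> _]] := netP_enum n; apply: sumr_ge0 => w _.
by apply: ltW; exact: weight_word_gt0.
Qed.

Lemma netP_level0 D : net_interval W 0 D -> netP W 0 D = 1.
Proof.
move=> /net_intervalP[a [b [/net_pair_level0[-> ->] ->]]].
have [s [us sP -> _]] := netP_enum 0.
have : perm_eq s [:: [::]].
  by apply: uniq_perm => // w; rewrite inE; apply/idP/eqP => [/sP|w0]; [|apply/sP].
move=> /(perm_big _) ->; rewrite big_mkcond big_seq1 /weight_word big_nil asboolT//.
by move=> x /=; rewrite in_itv /= => x01; exact/cylinderP.
Qed.

Lemma netP_gt0 n D : net_interval W n D -> 0 < netP W n D.
Proof.
move=> /net_intervalP[a [b [nab ->]]]; case: (nab) => na nb ab _.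
have /andP[a0 _] := net_point_itv01 na; have /andP[_ b1] := net_point_itv01 nb.
have [|u uL /cylinderP/andP[u1 u2]] := @Lambda_cylinder _ W W_attractor n ((a + b) / 2).
  by apply/andP; split; lra.
have [s [us sP -> _]] := netP_enum n.
rewrite lt0r sumr_ge0 ?andbT//; last by move=> w _; apply: ltW; exact: weight_word_gt0.
rewrite psumr_neq0; last by move=> w _; apply: ltW; exact: weight_word_gt0.
apply/hasP; exists u; first exact/sP.
rewrite weight_word_gt0 andbT; apply/asboolP.
by apply: (net_pair_cylinder nab uL); lra.
Qed.

(** Each word [u] counted in [netP W N D] extends to a word [g u] whose cylinder covers [D']. The
    map [g] is injective by [Lambda_antichain], and the appended letters lose only a factor
    exponential in [n]. *)
Lemma netP_le_subnet : exists2 C : R, 1 <= C & forall N n D D',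
  net_interval W N D -> net_interval W (N + n) D' -> D' `<=` D ->
  netP W N D <= C ^+ n.+1 * netP W (N + n) D'.
Proof.
have [rho [rho0 rho1 hrho]] := exists_scaling_bound W.
have [p [p0 p1 hp]] := exists_weight_bound W.
(* As [rho ^+ A < lambda], an appended word whose parent has ratio above [lambda ^+ n] has at most
   [A * n] letters, each of weight at least [p]. The exponent [A.+1 * n.+1] also covers the empty
   word. *)
have [A hA] := exists_expr_lt (ltW rho0) rho1 (lambda_gt0 W).
exists ((p ^+ A.+1)^-1); first by rewrite invf_ge1 ?exprn_gt0// exprn_ile1// ltW.
move=> N n D D' /net_intervalP[a [b [nab ->]]] /net_intervalP[c [d [ncd ->]]] sub.
have [s [us sP -> _]] := netP_enum N.
have [s' [us' sP' -> _]] := netP_enum (N + n).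
case: (ncd) => nc nd cd _.
(* Extending towards the midpoint of [[c, d]] yields a cylinder that meets its interior, hence
   covers it. *)
pose y := (c + d) / 2.
have ex u : exists v, Lambda N u -> `[a, b] `<=` cylinder u ->
    [/\ Lambda (N + n) (u ++ v), `[c, d] `<=` cylinder (u ++ v) & p ^+ A.+1 ^+ n.+1 <= weight_word v].
  have [[uL uc]|no] := pselect (Lambda N u /\ `[a, b] `<=` cylinder u); last first.
    by exists [::] => h1 h2; case: no.
  have yu : cylinder u y.
    by apply: uc; apply: sub => /=; rewrite in_itv /= /y; apply/andP; split; lra.
  have [v [vL /cylinderP/andP[v1 v2] vs]] :=
    @Lambda_extend _ W N n u (fun w => cylinder w y) uL (@cylinder_step _ W W_attractor y) yu.
  exists v => _ _; split => //.
    by apply: (net_pair_cylinder ncd vL); rewrite /y in v1 v2; lra.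
  apply: le_trans (weight_word_ge_exp v (ltW p0) hp).
  rewrite -exprM; apply: ler_wiXn2l; rewrite ?(ltW p0)//.
  case: vs => [->//|vs].
  have := lt_le_trans vs (scaling_word_le_exp _ hrho).
  have hAn : rho ^+ (A * n) <= lambda W ^+ n.
    by rewrite exprM; apply: lerXn2r; rewrite ?nnegrE ?exprn_ge0 ?(ltW (lambda_gt0 _)) ?ltW.
  move=> /(le_lt_trans hAn); rewrite ltr_iXn2l// size_take_min mulSn mulnS.
  by move: (A * n)%N (size v) => i j; lia.
pose g u := u ++ sval (cid (ex u)).
have gP u : Lambda N u -> `[a, b] `<=` cylinder u -> [/\ Lambda (N + n) (g u),
    `[c, d] `<=` cylinder (g u) & p ^+ A.+1 ^+ n.+1 * weight_word u <= weight_word (g u)].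
  move=> uL uc; rewrite /g; case: (cid (ex u)) => v /= /(_ uL uc)[v1 v2 v3]; split => //.
  by rewrite weight_word_cat mulrC ler_wpM2l// ltW// weight_word_gt0.
have C0 : 0 < p ^+ A.+1 ^+ n.+1 by rewrite !exprn_gt0.
rewrite exprVn -ler_pdivrMl ?invr_gt0// invrK.
rewrite -[X in _ * X <= _]big_filter -[leRHS]big_filter mulr_sumr.
apply: (@le_trans _ _ (\sum_(i <- [seq g u | u <- s & `[< `[a, b] `<=` cylinder u >]]) weight_word i)).
  rewrite big_map big_seq [leRHS]big_seq; apply: ler_sum => u.
  rewrite mem_filter => /andP[/asboolP uc /sP uL].
  by have [] := gP u uL uc.
apply: ler_sum_subset.
- rewrite map_inj_in_uniq ?filter_uniq// => u u'; rewrite !mem_filter.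
  move=> /andP[_ /sP uL] /andP[_ /sP uL'].
  exact: (Lambda_antichain uL uL').
- exact: filter_uniq.
- move=> x /mapP[u]; rewrite mem_filter => /andP[/asboolP uc /sP uL] ->.
  by rewrite mem_filter; have [gL gc _] := gP u uL uc; apply/andP; split; [exact/asboolP|exact/sP'].
- by move=> w; apply: ltW; exact: weight_word_gt0.
Qed.

End Net.

(** * Measures of balls *)

Lemma measurable_ballR (R : realType) (x r : R) :
  measurable (ball x r : set (measurableTypeR R)).
Proof. by rewrite ball_itv; exact: measurable_itv. Qed.

Section Support.
Context {R : realType} (mu : probability (measurableTypeR R) R).
Hypothesis mu_support : msupport mu = `[0, 1]%classic.

(** Every point off the support lies in a null ball with rational centre and radius, and [F]
    enumerates these countably many balls. *)
Lemma mu_notin_itv01_eq0 : mu (~` `[0, 1]) = 0%E.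
Proof.
have mC : measurable (~` `[0, 1] : set (measurableTypeR R)) by apply: measurableC.
apply/(negligibleP _ mC).
pose F k : set (measurableTypeR R) := if unpickle k is Some (p, q) then
  (if mu (ball (ratr p : R) (ratr q)) == 0%E then ball (ratr p : R) (ratr q) else set0)
  else set0.
apply: (@negligibleS _ _ _ mu (\bigcup_k F k)); last first.
  apply: negligible_bigcup => k; rewrite /F.
  case: (unpickle k) => [[p q]|]; last exact: negligible_set0.
  case: ifPn => [/eqP E|_]; last exact: negligible_set0.
  by apply/negligibleP => //; exact: measurable_ballR.
move=> x; rewrite -mu_support => /existsNP[r /not_implyP[r0 /negP]].
rewrite -leNgt measure_le0 => /eqP mur.
(* With radius below [r / 2] and a centre within that radius of [x], the rational ball contains [x]
   and stays inside the null ball [ball x r]. *)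
have [q /[!in_itv] /= /andP[q0 qr]] := rat_in_itvoo (divr_gt0 r0 (ltr0n R 2)).
have [p /[!in_itv] /= /andP[p1 p2]] := @rat_in_itvoo _ (x - ratr q) (x + ratr q) ltac:(lra).
have xpq : ball (ratr p : R) (ratr q) x.
  by rewrite /ball /= ltr_distl; apply/andP; split; lra.
have [k kE] : exists k, unpickle k = Some (p, q) by exists (pickle (p, q)); rewrite pickleK.
exists k => //; rewrite /F kE ifT//.
rewrite -measure_le0 -mur; apply: le_measure; rewrite ?inE; try exact: measurable_ballR.
move=> y; rewrite /ball /= !ltr_distl => /andP[y1 y2]; move: xpq.
by rewrite /ball /= ltr_distl => /andP[x1 x2]; apply/andP; split; lra.
Qed.

Lemma mu_disjoint_itv01 (E : set (measurableTypeR R)) :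
  measurable E -> (forall y : R, 0 <= y <= 1 -> ~ E y) -> mu E = 0%E.
Proof.
move=> mE En; apply/eqP; rewrite -measure_le0 -mu_notin_itv01_eq0.
apply: le_measure; rewrite ?inE//; first exact: measurableC.
by move=> y Ey /=; rewrite in_itv /= => /En.
Qed.

Lemma mu_contains_itv01 (E : set (measurableTypeR R)) :
  measurable E -> (forall y : R, 0 <= y <= 1 -> E y) -> mu E = 1%E.
Proof.
move=> mE En; have : mu (~` E) = 0%E.
  apply: mu_disjoint_itv01; first exact: measurableC.
  by move=> y /En Ey; exact.
rewrite probability_setC// -(fineK (fin_num_measure mu E mE)) -EFinB => -[h].
by rewrite (_ : fine (mu E) = 1)//; lra.
Qed.

End Support.

Section Measure.
Context {R : realType} (W : weighted_ifs R) (mu : probability (measurableTypeR R) R).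
Hypothesis mu_self_similar : self_similar W mu.
Implicit Types (u v w : seq (letter W)) (E : set (measurableTypeR R)).

Lemma measurable_smap_preimage (j : letter W) E :
  measurable E -> measurable (smap j @^-1` E : set (measurableTypeR R)).
Proof.
move=> mE; rewrite -[X in measurable X]setTI.
have : measurable_fun [set: measurableTypeR R] (smap j : measurableTypeR R -> measurableTypeR R).
  by apply: measurable_funD => //; apply: measurable_funM.
by apply.
Qed.

Lemma measurable_smap_word_preimage w E :
  measurable E -> measurable (smap_word w @^-1` E : set (measurableTypeR R)).
Proof.
by elim: w E => [//|j w IH] E mE; exact: IH (measurable_smap_preimage j mE).
Qed.

Lemma self_similar_fine E : measurable E ->
  fine (mu E) = \sum_(j < (nmaps W).+1) weight j * fine (mu (smap j @^-1` E)).
Proof.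
move=> mE; rewrite (mu_self_similar mE); apply: EFin_inj; rewrite fineK.
  rewrite -sumEFin; apply: eq_bigr => j _; rewrite EFinM fineK// fin_num_measure//.
  exact: measurable_smap_preimage.
apply/sum_fin_numP => j _ _; rewrite fin_numM// fin_num_measure//.
exact: measurable_smap_preimage.
Qed.

(** This is the splitting hypothesis of [Lambda_enum]; it turns self-similarity into
    $\mu(E)=\sum_{u\in\Lambda_n}p_u\,\mu(S_u^{-1}E)$. *)
Lemma self_similar_step E u : measurable E ->
  weight_word u * fine (mu (smap_word u @^-1` E)) =
  \sum_(j < (nmaps W).+1) weight_word (rcons u j) * fine (mu (smap_word (rcons u j) @^-1` E)).
Proof.
move=> mE; rewrite (self_similar_fine (measurable_smap_word_preimage u mE)) mulr_sumr.
apply: eq_bigr => j _; rewrite mulrA -cats1 weight_word_cat /weight_word big_seq1.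
congr (_ * fine (mu _)); apply: funext => x.
by rewrite /preimage /= smap_word_cat.
Qed.

End Measure.

Section BallNet.
Context {R : realType} (W : weighted_ifs R) (mu : probability (measurableTypeR R) R).
Hypothesis W_attractor : is_attractor W `[0, 1].
Hypothesis mu_self_similar : self_similar W mu.
Hypothesis mu_support : msupport mu = `[0, 1]%classic.
Implicit Types (u v w : seq (letter W)) (a b x rho K : R) (D : set R).

Lemma netP_le_ball n D x : net_interval W n D -> D x ->
  netP W n D <= fine (mu (ball x (2 * lambda W ^+ n))).
Proof.
move=> nD Dx; have [s [us sP -> sF]] := netP_enum W n.
have mB := @measurable_ballR R x (2 * lambda W ^+ n).
have := sF _ (fun w => weight_word w * fine (mu (smap_word w @^-1` ball x (2 * lambda W ^+ n))))
  (fun u => self_similar_step mu_self_similar u mB).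
rewrite {1}/weight_word big_nil mul1r => ->.
rewrite big_mkcond big_seq [leRHS]big_seq; apply: ler_sum => w /sP wL.
have w0 := weight_word_gt0 w.
case: ifPn => [/asboolP Dw|_]; last by rewrite mulr_ge0 ?(ltW w0)// fine_ge0.
(* The cylinder of [w] contains [x] and has length at most [lambda ^+ n], so [smap_word w] sends all
   of [[0, 1]] into the ball. *)
rewrite (mu_contains_itv01 mu_support) ?mulr1//; first exact: measurable_smap_word_preimage.
move=> y y01; rewrite /preimage /ball /=.
have /cylinderP/andP[x1 x2] := Dw _ Dx.
have /cylinderP/andP[y1 y2] : cylinder w (smap_word w y) by exists y => //=; rewrite in_itv.
have /LambdaP[wn _] := wL; rewrite smap_word1E in x2 y2.
by have := lambdaX_gt0 W n; rewrite ltr_distl => ?; apply/andP; split; lra.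
Qed.

(* Two of the three points are endpoints of the same type. *)
Lemma net_point_ball_three n x rho h1 h2 h3 :
  (forall u w z, Lambda (W := W) n u -> Lambda n w -> z = 0 \/ z = 1 ->
     smap_word u z <> smap_word w z -> 2 * rho <= `|smap_word u z - smap_word w z|) ->
  net_point W n h1 -> net_point W n h2 -> net_point W n h3 ->
  x - rho < h1 -> h1 < h2 -> h2 < h3 -> h3 < x + rho -> False.
Proof.
move=> sep n1 n2 n3 h1x h12 h23 h3x.
have key u w z h h' : Lambda (W := W) n u -> Lambda n w -> z = 0 \/ z = 1 ->
    h = smap_word u z -> h' = smap_word w z -> x - rho < h -> h < h' -> h' < x + rho -> False.
  move=> uL wL z01 -> -> h0 hh h'0.
  have := sep _ _ _ uL wL z01 (ltac:(by move=> E; rewrite E ltxx in hh)).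
  by rewrite leNgt => /negP; apply; rewrite ltr_distl; apply/andP; split; lra.
case: n1 n2 n3 => [u1 L1 [E1|E1]] [u2 L2 [E2|E2]] [u3 L3 [E3|E3]].
- by apply: (key u1 u2 0 h1 h2) => //; [left|lra].
- by apply: (key u1 u2 0 h1 h2) => //; [left|lra].
- by apply: (key u1 u3 0 h1 h3) => //; [left|lra].
- by apply: (key u2 u3 1 h2 h3) => //; [right|lra].
- by apply: (key u2 u3 0 h2 h3) => //; [left|lra].
- by apply: (key u1 u3 1 h1 h3) => //; [right|lra].
- by apply: (key u1 u2 1 h1 h2) => //; [right|lra].
- by apply: (key u1 u2 1 h1 h2) => //; [right|lra].
Qed.

Lemma adjacent_itv a b c : a < b -> b < c -> adjacent `[a, b] `[b, c].
Proof.
move=> ab bc; split.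
  move=> /seteqP[+ _] => /(_ a); rewrite /= !in_itv /= lexx (ltW ab) => /(_ isT).
  by rewrite leNgt ab.
by exists b; rewrite /= !in_itv /= !lexx !ltW.
Qed.

(** * Net intervals covered by the cylinders that meet a small ball *)

Section Neighbours.
Variables (n : nat) (a b x rho K : R).
Hypothesis K1 : 1 <= K.
Hypothesis comparable : forall D1 D2, net_interval W n D1 -> net_interval W n D2 ->
  adjacent D1 D2 -> netP W n D1 <= K * netP W n D2.
Hypothesis separated : forall u w z, Lambda (W := W) n u -> Lambda n w -> z = 0 \/ z = 1 ->
  smap_word u z <> smap_word w z -> 2 * rho <= `|smap_word u z - smap_word w z|.
Hypothesis rho0 : 0 < rho.
Hypothesis nab : net_pair W n a b.
Hypothesis xab : a <= x <= b.

Let P := netP W n `[a, b].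
Let P0 : 0 <= P := netP_ge0 W n `[a, b].

Lemma adjacent_sym D1 D2 : adjacent D1 D2 -> adjacent D2 D1.
Proof. by move=> [n12 I12]; split; [exact/nesym|rewrite setIC]. Qed.

(** [D1] and [D2] are the next two net intervals [[b, c]] and [[c, f]]. A cylinder starting in [[b,
    c[] covers the first, one starting in [[c, f[] the second, and a later start would put three net
    points in the ball. Two adjacency steps cost [K ^+ 2]. *)
Lemma right_neighbours : exists D1 D2,
  [/\ netP W n D1 <= K ^+ 2 * P, netP W n D2 <= K ^+ 2 * P &
   forall u, Lambda n u -> b <= smap_word u 0 -> smap_word u 0 < x + rho ->
     D1 `<=` cylinder u \/ D2 `<=` cylinder u].
Proof.
have KP : P <= K * P by rewrite ler_peMl.
have KKP : K * P <= K ^+ 2 * P by rewrite expr2 -mulrA ler_pM2l// (lt_le_trans _ K1).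
have [na nb ab _] := nab.
have npu u z : Lambda n u -> z = 0 \/ z = 1 -> net_point W n (smap_word u z).
  by move=> uL [] ->; exists u => //; [left|right].
have [[d nd bd]|none] := pselect (exists2 d, net_point W n d & b < d); last first.
  (* With no net point beyond [b] no word qualifies, and [[a, b]] is a placeholder. *)
  exists `[a, b]%classic, `[a, b]%classic; split; rewrite ?(le_trans KP)// => u uL bu _.
  case: none; exists (smap_word u 1); first by apply: npu => //; right.
  exact: le_lt_trans bu (smap_word_lt01 u).
have [c nbc _] := net_pair_right nb nd bd; have [_ nc bc _] := nbc.
have Pbc : netP W n `[b, c] <= K * P.
  apply: comparable; [exact: net_pair_interval nbc|exact: net_pair_interval nab|].
  by apply: adjacent_sym; exact: adjacent_itv.
have [[e ne ce]|none] := pselect (exists2 e, net_point W n e & c < e); last first.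
  (* [c] is the last net point, so every qualifying cylinder starts before it and covers [[b, c]],
     which serves twice. *)
  exists `[b, c]%classic, `[b, c]%classic; split; rewrite ?(le_trans Pbc)// => u uL bu _; left.
  have u1 := smap_word_lt01 u.
  apply: (net_pair_cylinder nbc) => //; last exact: le_lt_trans bu u1.
  rewrite ltNge; apply/negP => cu; apply: none; exists (smap_word u 1).
    by apply: npu => //; right.
  exact: le_lt_trans cu u1.
have [f ncf _] := net_pair_right nc ne ce; have [_ nf cf _] := ncf.
have Pcf : netP W n `[c, f] <= K ^+ 2 * P.
  rewrite expr2 -mulrA (@le_trans _ _ (K * netP W n `[b, c]))//.
    apply: comparable; [exact: net_pair_interval ncf|exact: net_pair_interval nbc|].
    by apply: adjacent_sym; exact: adjacent_itv.
  by rewrite ler_pM2l// (lt_le_trans _ K1).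
exists `[b, c]%classic, `[c, f]%classic; split; rewrite ?(le_trans Pbc)// => u uL bu ux.
have u1 := smap_word_lt01 u.
have [cu|uc] := leP c (smap_word u 0); last first.
  by left; apply: (net_pair_cylinder nbc) => //; exact: le_lt_trans bu u1.
right; apply: (net_pair_cylinder ncf) => //; last exact: le_lt_trans cu u1.
rewrite ltNge; apply/negP => fu; case/andP: xab => ax xb.
apply: (@net_point_ball_three n x rho b c (smap_word u 0)) => //; try lra.
by apply: npu => //; left.
Qed.

(** Mirror image of [right_neighbours], with right endpoints of cylinders in place of left ones. *)
Lemma left_neighbours : exists D1 D2,
  [/\ netP W n D1 <= K ^+ 2 * P, netP W n D2 <= K ^+ 2 * P &
   forall u, Lambda n u -> smap_word u 1 <= a -> x - rho < smap_word u 1 ->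
     D1 `<=` cylinder u \/ D2 `<=` cylinder u].
Proof.
have KP : P <= K * P by rewrite ler_peMl.
have KKP : K * P <= K ^+ 2 * P by rewrite expr2 -mulrA ler_pM2l// (lt_le_trans _ K1).
have [na nb ab _] := nab.
have npu u z : Lambda n u -> z = 0 \/ z = 1 -> net_point W n (smap_word u z).
  by move=> uL [] ->; exists u => //; [left|right].
have [[d nd da]|none] := pselect (exists2 d, net_point W n d & d < a); last first.
  exists `[a, b]%classic, `[a, b]%classic; split; rewrite ?(le_trans KP)// => u uL ua _.
  case: none; exists (smap_word u 0); first by apply: npu => //; left.
  exact: lt_le_trans (smap_word_lt01 u) ua.
have [c nca _] := net_pair_left nd na da; have [nc _ ca _] := nca.
have Pca : netP W n `[c, a] <= K * P.
  apply: comparable; [exact: net_pair_interval nca|exact: net_pair_interval nab|].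
  exact: adjacent_itv.
have [[e ne ec]|none] := pselect (exists2 e, net_point W n e & e < c); last first.
  exists `[c, a]%classic, `[c, a]%classic; split; rewrite ?(le_trans Pca)// => u uL ua _; left.
  have u1 := smap_word_lt01 u.
  apply: (net_pair_cylinder nca) => //; first exact: lt_le_trans u1 ua.
  rewrite ltNge; apply/negP => uc; apply: none; exists (smap_word u 0).
    by apply: npu => //; left.
  exact: lt_le_trans u1 uc.
have [f nfc _] := net_pair_left ne nc ec; have [nf _ fc _] := nfc.
have Pfc : netP W n `[f, c] <= K ^+ 2 * P.
  rewrite expr2 -mulrA (@le_trans _ _ (K * netP W n `[c, a]))//.
    apply: comparable; [exact: net_pair_interval nfc|exact: net_pair_interval nca|].
    exact: adjacent_itv.
  by rewrite ler_pM2l// (lt_le_trans _ K1).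
exists `[c, a]%classic, `[f, c]%classic; split; rewrite ?(le_trans Pca)// => u uL ua ux.
have u1 := smap_word_lt01 u.
have [uc|cu] := leP (smap_word u 1) c; last first.
  by left; apply: (net_pair_cylinder nca) => //; exact: lt_le_trans u1 ua.
right; apply: (net_pair_cylinder nfc) => //; first exact: lt_le_trans u1 uc.
rewrite ltNge; apply/negP => fu; case/andP: xab => ax xb.
apply: (@net_point_ball_three n x rho (smap_word u 1) c a) => //; try lra.
by apply: npu => //; right.
Qed.

(** A cylinder meeting the ball starts at or after [b], ends at or before [a], or covers [[a, b]].
    So its weight is counted in [netP] of one of five intervals: [[a, b]] and two on each side. *)
Lemma ball_le_netP : fine (mu (ball x rho)) <= 5 * K ^+ 2 * P.
Proof.
have [D1 [D2 [D1P D2P DR]]] := right_neighbours.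
have [D3 [D4 [D3P D4P DL]]] := left_neighbours.
have [s [us sP sE sF]] := netP_enum W n.
have mB := @measurable_ballR R x rho.
have := sF _ (fun w => weight_word w * fine (mu (smap_word w @^-1` ball x rho)))
  (fun u => self_similar_step mu_self_similar u mB).
rewrite {1}/weight_word big_nil mul1r => ->.
have PK : P <= K ^+ 2 * P by rewrite ler_peMl// exprn_ege1.
apply: (@le_trans _ _ (P + netP W n D1 + netP W n D2 + netP W n D3 + netP W n D4)); last lra.
rewrite /P !sE; do ?rewrite [in leRHS](big_mkcond (fun w => `[< _ `<=` cylinder w >])) /=.
rewrite -!big_split /= big_seq [leRHS]big_seq; apply: ler_sum => w /sP wL.
have w0 := weight_word_gt0 w.
pose ind D : R := if `[< D `<=` cylinder w >] then weight_word w else 0.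
rewrite -/(ind `[a, b]%classic) -/(ind D1) -/(ind D2) -/(ind D3) -/(ind D4).
have c0 D : 0 <= ind D by rewrite /ind; case: ifP => _ //; exact: ltW.
have c1 D : D `<=` cylinder w -> ind D = weight_word w by move=> Dw; rewrite /ind asboolT.
have mS := measurable_smap_word_preimage w mB.
have m0 : 0 <= weight_word w * fine (mu (smap_word w @^-1` ball x rho)).
  by rewrite mulr_ge0 ?fine_ge0// ltW.
have m1 : weight_word w * fine (mu (smap_word w @^-1` ball x rho)) <= weight_word w.
  rewrite ler_piMr ?(ltW w0)// -[leRHS]/(fine 1%E) fine_le ?fin_num_measure//.
  exact: probability_le1.
have cov D : D `<=` cylinder w -> weight_word w * fine (mu (smap_word w @^-1` ball x rho)) <=
    ind D by move=> /c1 ->.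
have := (c0 `[a, b]%classic, c0 D1, c0 D2, c0 D3, c0 D4).
move=> [[[[h0 h1] h2] h3] h4].
have [[y y01 yB]|no] := pselect (exists2 y, 0 <= y <= 1 & (smap_word w @^-1` ball x rho) y); last first.
  rewrite (mu_disjoint_itv01 mu_support) ?mulr0//; first by lra.
  by move=> y y01 By; apply: no; exists y.
have /cylinderP/andP[y1 y2] : cylinder w (smap_word w y) by exists y => //=; rewrite in_itv.
move: yB; rewrite /preimage /ball /= ltr_distl => /andP[By1 By2].
have [bw|wb] := leP b (smap_word w 0).
  have wx : smap_word w 0 < x + rho by lra.
  by case: (DR w wL bw wx) => /cov; lra.
have [wa|aw] := leP (smap_word w 1) a.
  have wx : x - rho < smap_word w 1 by lra.
  by case: (DL w wL wa wx) => /cov; lra.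
by have /cov := net_pair_cylinder nab wL wb aw; lra.
Qed.

End Neighbours.

End BallNet.

(** * Upper and lower limits along scales *)

(** Compares upper limits along unrelated filters, here radii tending to 0 and levels tending to
    infinity: a far point of one must be matched, up to [e], by a point of the other arbitrarily far
    out. *)
Lemma limf_esup_le (R : realType) (T S : choiceType) (X : filteredType T) (Y : filteredType S)
    (F : set_system X) (G : set_system Y) (f : X -> \bar R) (g : Y -> \bar R) :
  (forall (e : R) B, 0 < e -> G B -> \forall x \near F, exists2 y, B y & (f x <= g y + e%:E)%E) ->
  (limf_esup f F <= limf_esup g G)%E.
Proof.
move=> fg; apply/lee_addgt0Pr => e e0; rewrite -leeBlDr//.
apply: le_ereal_inf_tmp => _ [B GB <-]; rewrite leeBlDr//.
apply: (@le_trans _ _ (ereal_sup (f @` [set x | exists2 y, B y & (f x <= g y + e%:E)%E]))).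
  by apply: ereal_inf_lbound; exists [set x | exists2 y, B y & (f x <= g y + e%:E)%E] => //; exact: fg.
apply: ge_ereal_sup => _ [x [y By fxgy] <-]; apply: (le_trans fxgy).
by rewrite leeD2r//; apply: ereal_sup_ubound; exists y.
Qed.

Lemma limf_einf_le (R : realType) (T S : choiceType) (X : filteredType T) (Y : filteredType S)
    (F : set_system X) (G : set_system Y) (f : X -> \bar R) (g : Y -> \bar R) :
  (forall (e : R) B, 0 < e -> F B -> \forall y \near G, exists2 x, B x & (- g y <= - f x + e%:E)%E) ->
  (limf_einf f F <= limf_einf g G)%E.
Proof. by move=> fg; rewrite leeN2; exact: limf_esup_le. Qed.

(** * Matching radii with levels on a logarithmic scale *)

Section LogScale.
Context {R : realType} (a : R).
Hypothesis a0 : 0 < a.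

Definition log_close (eta r : R) (n : nat) :=
  (1 - eta) * (n%:R * a) <= - ln r <= (1 + eta) * (n%:R * a).

Section Sequence.
Variable h : nat -> R.
Hypothesis h_gt0 : forall n, 0 < h n.
Hypothesis h_rate : ln (h n) / n%:R @[n --> \oo] --> - a.

Lemma log_close_near eta : 0 < eta -> exists K : nat, forall n, (K <= n)%N -> log_close eta (h n) n.
Proof.
move=> e0; have /cvgrPdist_le/(_ (eta * a)) := h_rate.
move=> /(_ (mulr_gt0 e0 a0)) [K _ hK].
exists K.+1 => n Kn; have n0 : 0 < n%:R :> R by rewrite ltr0n; lia.
have := hK n (ltac:(rewrite /=; lia)); rewrite ler_distl => /andP[h1 h2].
have {}h1 : ln (h n) / n%:R <= eta * a - a by lra.
have {}h2 : - a - eta * a <= ln (h n) / n%:R by lra.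
rewrite ler_pdivrMr// in h1; rewrite ler_pdivlMr// in h2.
by rewrite /log_close; apply/andP; split; lra.
Qed.

(** [h] need not be monotone, so [n.+1] is taken as the first index from a threshold [K0] on with
    [h n.+1 < r]. Taking [r < h K0] ensures that its predecessor is also past the threshold. *)
Lemma scale_index eta (K : nat) : 0 < eta -> eta <= 1 ->
  exists2 delta : R, 0 < delta & forall r : R, 0 < r -> r < delta ->
    exists n, [/\ (K <= n)%N, r <= h n, log_close eta r n, h n.+1 <= r & log_close eta r n.+1].
Proof.
move=> e0 e1; have [K1 hK1] := @log_close_near (eta / 2) ltac:(lra).
(* Half of [eta] is spent on [h] itself; past [K2] the other half pays for the shift between [n] and
   [n.+1]. *)
have [K2 hK2] : exists K2 : nat, 1 + 2 / eta < K2%:R.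
  by exists (Num.truncn (1 + 2 / eta)).+1; exact: truncnS_gt.
have [K0 [kK kK1 kK2]] : exists K0, [/\ (K <= K0)%N, (K1 <= K0)%N & (K2 <= K0)%N].
  by exists (maxn K (maxn K1 K2)); rewrite !leq_max !leqnn !orbT.
exists (h K0) => // r r0 rh.
have exm : exists m, (K0 <= m)%N && (h m < r).
  have [m hm] : exists m : nat, - ln r / (a / 2) < m%:R.
    by exists (Num.truncn (- ln r / (a / 2))).+1; exact: truncnS_gt.
  exists (maxn K0 m); rewrite leq_maxl /= -ltr_ln ?posrE//.
  have /hK1/andP[h1 _] : (K1 <= maxn K0 m)%N by rewrite leq_max kK1.
  have m_le : m%:R <= (maxn K0 m)%:R :> R by rewrite ler_nat leq_maxr.
  rewrite ltr_pdivrMr ?divr_gt0// in hm.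
  have hm' : m%:R * (a / 2) <= (maxn K0 m)%:R * (a / 2) by rewrite ler_pM2r// divr_gt0.
  have : 0 <= (1 - eta) / 2 * ((maxn K0 m)%:R * a).
    apply: mulr_ge0; first lra.
    by rewrite mulr_ge0// ltW.
  lra.
have [m /andP[K0m hmr] mmin] := ex_minnP exm.
have mK0 : (K0 < m)%N.
  by rewrite ltn_neqAle K0m andbT; apply/eqP => mE; rewrite -mE ltNge (ltW rh) in hmr.
case: m K0m hmr mmin mK0 => // n K0m hmr mmin K0n.
have rhn : r <= h n.
  rewrite leNgt; apply/negP => hn; have := mmin n; rewrite hn andbT => /(_ K0n); by rewrite ltnn.
have /andP[h1 h1'] : log_close (eta / 2) (h n) n by apply: hK1; exact: leq_trans kK1 K0n.
have /andP[h2 h2'] : log_close (eta / 2) (h n.+1) n.+1 by apply: hK1; exact: leq_trans kK1 K0m.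
have lr1 : ln r <= ln (h n) by rewrite ler_ln ?posrE ?h_gt0.
have lr2 : ln (h n.+1) <= ln r by rewrite ler_ln ?posrE ?h_gt0// ltW.
have nK2 : 1 + 2 / eta < n%:R :> R.
  by apply: (lt_le_trans hK2); rewrite ler_nat (leq_trans kK2).
have neta : eta + 2 < n%:R * eta.
  by rewrite -(ltr_pM2r e0) mulrDl mul1r divfK ?gt_eqF// in nK2.
have na : (eta + 2) * a < n%:R * eta * a by rewrite ltr_pM2r.
have ea : eta * a <= a by rewrite ler_piMl// ltW.
have ea0 : 0 <= eta * a by rewrite mulr_ge0// ltW.
rewrite -(natr1 n) in h2 h2'.
exists n; split => //; last 2 first.
- exact: ltW.
- by rewrite /log_close -(natr1 n); apply/andP; split; lra.
- exact: leq_trans kK K0n.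
- by rewrite /log_close; apply/andP; split; lra.
Qed.

End Sequence.
End LogScale.

Lemma lt_natr_bound (R : realType) (x : R) : exists K : nat, forall n, (K <= n)%N -> x < n%:R.
Proof.
exists (Num.truncn x).+1 => n Kn; apply: (lt_le_trans (truncnS_gt x)).
by rewrite ler_nat.
Qed.

Lemma near_at_right0 (R : realType) (P : R -> Prop) :
  (\forall r \near 0^'+, P r) <-> exists2 d : R, 0 < d & forall r, 0 < r -> r < d -> P r.
Proof.
split=> [|[d d0 dP]].
  case=> d /= d0 dP; exists d => // r r0 rd; apply: dP => //=.
  by rewrite sub0r normrN gtr0_norm.
near=> r; apply: dP; near: r; [exact: nbhs_right_gt|exact: nbhs_right_lt].
Unshelve. all: by end_near. Qed.

(** * Local dimensions: quotients over radii against quotients over levels *)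

Section LocalDimension.
Context {R : realType} (a M : R) (p h1 h2 : nat -> R) (m : R -> R).
Hypothesis a0 : 0 < a.
Hypothesis p0 : forall n, 0 < p n.
Hypothesis p1 : forall n, p n <= 1.
Hypothesis m0 : forall r, 0 < r -> 0 < m r.
Hypothesis m1 : forall r, m r <= 1.
Hypothesis M0 : 0 <= M.
Hypothesis pM : forall n, (0 < n)%N -> - ln (p n) <= M * (n%:R * a).
Hypothesis h1_gt0 : forall n, 0 < h1 n.
Hypothesis h1_rate : ln (h1 n) / n%:R @[n --> \oo] --> - a.
Hypothesis h2_gt0 : forall n, 0 < h2 n.
Hypothesis h2_rate : ln (h2 n) / n%:R @[n --> \oo] --> - a.
Hypothesis p_le_m : forall n r, 0 < r -> h1 n <= r -> p n <= m r.
Hypothesis m_le_p : forall q, 1 < q -> exists2 C, 0 < C &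
  forall n r, 0 < r -> r <= h2 n -> m r <= C * q ^+ n * p n.

(** Here [p n] stands for $P_n(\Delta_n(x))$ and [m r] for $\mu(B(x,r))$; [h1] and [h2] stand for
    $2\lambda^n$ and $f(n)\lambda^n/2$, and [a] for $-\log\lambda$. The hypothesis [pM] makes [u]
    bounded by [M]. *)
Let g r := ln (m r) / ln r.
Let u n := ln (p n) / (n%:R * - a).

Lemma local_rate_upper e : 0 < e -> exists2 eta, 0 < eta <= 1 &
  forall n r, (0 < n)%N -> 0 < r -> r < 1 -> h1 n <= r -> log_close a eta r n -> g r <= u n + e.
Proof.
(* Chosen so that [eta * (u n + e) <= e], from [eta * M <= e / 2] and [eta <= 2^-1]: boundedness of
   [u] turns the relative error in [ln r] into an additive one. *)
move=> e0; pose eta := Num.min (2^-1) (e / (2 * (M + 1))).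
have M1 : 0 < M + 1 by rewrite ltr_wpDl.
have eta0 : 0 < eta by rewrite lt_min invr_gt0 ltr0n divr_gt0// mulr_gt0.
have eta2 : eta <= 2^-1 by rewrite ge_min lexx.
have etaM : eta * (2 * (M + 1)) <= e by rewrite -ler_pdivlMr ?mulr_gt0// ge_min lexx orbT.
clearbody eta; have eta1 : eta <= 1 by lra.
exists eta => [|n r n0 r0 r1 hr /andP[hY _]]; first by rewrite eta0.
have x0 : 0 < n%:R * a by rewrite mulr_gt0// ltr0n.
have lr : ln r < 0 by rewrite ln_lt0// r0.
have lm : ln (p n) <= ln (m r) by rewrite ler_ln ?posrE ?m0 ?p0// p_le_m.
have := pM n0; set x := n%:R * a in x0 hY *; set Y := ln r in lr hY *.
have tE : - ln (p n) = u n * x by rewrite /u mulrN invrN mulrN mulNr divfK ?gt_eqF.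
rewrite tE ler_pM2r// => tM.
have t0 : 0 <= u n.
  by rewrite -(pmulr_lge0 _ x0) -tE oppr_ge0 ln_le0.
rewrite /g -/Y ler_ndivrMr//.
have : (1 - eta) * x * (u n + e) <= - Y * (u n + e) by rewrite ler_pM2r//; lra.
have : 0 <= x * (e - eta * (u n + e)); last by lra.
rewrite mulr_ge0 ?(ltW x0)// subr_ge0.
have : eta * u n <= eta * M by rewrite ler_pM2l.
have : eta * e <= 2^-1 * e by rewrite ler_pM2r.
lra.
Qed.

Lemma local_rate_lower e : 0 < e -> exists eta K, [/\ 0 < eta, eta <= 1 &
  forall n r, (K <= n)%N -> 0 < r -> r < 1 -> r <= h2 n -> log_close a eta r n ->
    u n <= g r + e].
Proof.
move=> e0; pose eta := Num.min 1 (e / (2 * (M + 1))).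
have M1 : 0 < M + 1 by rewrite ltr_wpDl.
have eta0 : 0 < eta by rewrite lt_min ltr01 divr_gt0// mulr_gt0.
have eta1 : eta <= 1 by rewrite ge_min lexx.
have etaM : eta * (2 * (M + 1)) <= e by rewrite -ler_pdivlMr ?mulr_gt0// ge_min lexx orbT.
clearbody eta; have ae : 0 < a * (e / 4) by rewrite mulr_gt0// divr_gt0.
(* This [q] costs [n * a * e / 4] in the logarithm, and for [n >= K] so does the constant [C] at
   most; the remaining [e / 2] pays for [eta]. *)
have [|C C0 hC] := m_le_p (q := expR (a * (e / 4))); first by rewrite expR_gt1.
have [K hK] := lt_natr_bound (ln C / (a * (e / 4))).
exists eta, (maxn K 1); split => // n r; rewrite geq_max => /andP[/hK nK n0] r0 r1 hr /andP[_ hY].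
rewrite ltr_pdivrMr// in nK.
have x0 : 0 < n%:R * a by rewrite mulr_gt0// ltr0n.
have lr : ln r < 0 by rewrite ln_lt0// r0.
have lm : ln (m r) <= ln C + n%:R * (a * (e / 4)) + ln (p n).
  rewrite (le_trans (y := ln (C * expR (a * (e / 4)) ^+ n * p n)))//.
    by rewrite ler_ln ?posrE ?m0 ?mulr_gt0 ?exprn_gt0 ?expR_gt0 ?p0// hC.
  by rewrite !lnM ?posrE ?mulr_gt0 ?exprn_gt0 ?expR_gt0 ?p0// lnXn ?expR_gt0// expRK mulr_natl.
have lm0 : ln (m r) <= 0 by rewrite ln_le0.
have := pM n0.
have tE : - ln (p n) = u n * (n%:R * a) by rewrite /u mulrN invrN mulrN mulNr divfK ?gt_eqF.
rewrite tE ler_pM2r// => tM.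
have sE : ln (m r) = g r * ln r by rewrite /g divfK// lt_eqF.
have s0 : 0 <= g r by rewrite -(nmulr_lle0 _ lr) -sE.
(* If [g r >= M] then [u n <= M] suffices; otherwise [g r < M] controls the error [eta * g r]. *)
have [Ms|sM] := leP M (g r); first by lra.
have : (u n - g r - e) * (n%:R * a) <= 0; last by rewrite pmulr_lle0//; lra.
have h3 : g r * (- ln r) <= g r * ((1 + eta) * (n%:R * a)) by rewrite ler_wpM2l.
have h4 : eta * g r * (n%:R * a) <= e / 2 * (n%:R * a).
  rewrite ler_pM2r//; have : eta * g r <= eta * M by rewrite ler_pM2l// ltW.
  lra.
lra.
Qed.

Lemma rate_seq_small h : (forall n, 0 < h n) -> ln (h n) / n%:R @[n --> \oo] --> - a ->
  forall d : R, 0 < d -> exists K : nat, forall n, (K <= n)%N -> h n < d.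
Proof.
move=> h0 hr d d0; have [K hK] := log_close_near a0 hr (ltac:(lra) : 0 < 2^-1).
have [K' hK'] := lt_natr_bound (- ln d / (a / 2)).
exists (maxn K K') => n; rewrite geq_max => /andP[/hK/andP[h3 _] /hK'].
rewrite ltr_pdivrMr ?divr_gt0// => h4.
by rewrite -ltr_ln ?posrE//; lra.
Qed.

(** Each rate inequality is used both ways: a radius is sent to a level by [scale_index], and a
    level to the radius [h1 n] or [h2 n]. This gives the four comparisons. *)
Lemma local_dimension_eq (G : R -> \bar R) :
  (forall r, 0 < r -> r < 1 -> G r = (g r)%:E) ->
  limf_esup G 0^'+ = limn_esup (fun n => (u n)%:E) /\
  limf_einf G 0^'+ = limn_einf (fun n => (u n)%:E).
Proof.
move=> GE.
have upper_r (e : R) K : 0 < e -> \forall r \near 0^'+, exists2 n, (K <= n)%N &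
    (0 < r < 1) /\ g r <= u n + e.
  move=> e0; have [eta /andP[eta0 eta1] He] := local_rate_upper e0.
  have [d d0 dP] := scale_index a0 h1_gt0 h1_rate (maxn K 1) eta0 eta1.
  apply/near_at_right0; exists (Num.min d 1); first by rewrite lt_min d0 ltr01.
  move=> r r0; rewrite lt_min => /andP[rd r1].
  have [n [nK _ _ hn nr]] := dP r r0 rd.
  exists n.+1; first by rewrite (leq_trans (leq_maxl K 1))// leqW.
  by split; [rewrite r0|exact: He].
have lower_r (e : R) K : 0 < e -> \forall r \near 0^'+, exists2 n, (K <= n)%N &
    (0 < r < 1) /\ u n <= g r + e.
  move=> e0; have [eta [K' [eta0 eta1 He]]] := local_rate_lower e0.
  have [d d0 dP] := scale_index a0 h2_gt0 h2_rate (maxn K K') eta0 eta1.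
  apply/near_at_right0; exists (Num.min d 1); first by rewrite lt_min d0 ltr01.
  move=> r r0; rewrite lt_min => /andP[rd r1].
  have [n [nK hn nr _ _]] := dP r r0 rd.
  rewrite geq_max in nK; case/andP: nK => nK nK'.
  by exists n => //; split; [rewrite r0|exact: He].
have upper_n (e : R) (B : set R) : 0 < e -> (\forall r \near 0^'+, B r) ->
    \forall n \near \oo, exists2 r, B r & (0 < r < 1) /\ g r <= u n + e.
  move=> e0 /near_at_right0[d d0 dP]; have [eta /andP[eta0 eta1] He] := local_rate_upper e0.
  have [K hK] := log_close_near a0 h1_rate eta0.
  have [K' hK'] := rate_seq_small h1_gt0 h1_rate (ltac:(rewrite lt_min d0 ltr01//) : 0 < Num.min d 1).
  exists (maxn K (maxn K' 1)) => // n /=; rewrite !geq_max => /and3P[/hK nr /hK'].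
  rewrite lt_min => /andP[hd h1'] n0; exists (h1 n); first exact: dP.
  by split; [rewrite h1_gt0|exact: He].
have lower_n (e : R) (B : set R) : 0 < e -> (\forall r \near 0^'+, B r) ->
    \forall n \near \oo, exists2 r, B r & (0 < r < 1) /\ u n <= g r + e.
  move=> e0 /near_at_right0[d d0 dP]; have [eta [K0 [eta0 eta1 He]]] := local_rate_lower e0.
  have [K hK] := log_close_near a0 h2_rate eta0.
  have [K' hK'] := rate_seq_small h2_gt0 h2_rate (ltac:(rewrite lt_min d0 ltr01//) : 0 < Num.min d 1).
  exists (maxn K (maxn K' K0)) => // n /=; rewrite !geq_max => /and3P[/hK nr /hK'].
  rewrite lt_min => /andP[hd h1'] n0; exists (h2 n); first exact: dP.
  by split; [rewrite h2_gt0|exact: He].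
split; apply/eqP; rewrite eq_le; apply/andP; split.
- apply: limf_esup_le => e B e0 [K _ KB]; apply: filterS (upper_r e K e0).
  move=> r [n Kn [/andP[r0 r1] gu]]; exists n; first exact: KB.
  by rewrite GE// -EFinD lee_fin.
- apply: limf_esup_le => e B e0 GB; apply: filterS (lower_n e B e0 GB).
  move=> n [r Br [/andP[r0 r1] gu]]; exists r => //.
  by rewrite GE// -EFinD lee_fin.
- apply: limf_einf_le => e B e0 GB; apply: filterS (upper_n e B e0 GB).
  move=> n [r Br [/andP[r0 r1] gu]]; exists r => //.
  by rewrite GE// -!EFinN -EFinD lee_fin; lra.
- apply: limf_einf_le => e B e0 [K _ KB]; apply: filterS (lower_r e K e0).
  move=> r [n Kn [/andP[r0 r1] gu]]; exists n; first exact: KB.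
  by rewrite GE// -!EFinN -EFinD lee_fin; lra.
Qed.

End LocalDimension.

(** * Quasi-Assouad dimension *)

Section QuasiAssouad.
Context {R : realType} (T : Type) (a delta s s' : R) (p : T -> nat -> R) (Q h1 h2 : nat -> R) (m : T -> R -> R).
Hypothesis a0 : 0 < a.
Hypothesis delta0 : 0 < delta.
Hypothesis s'0 : 0 <= s'.
Hypothesis s's : s' < s.
Hypothesis m0 : forall x r, 0 <= m x r.
Hypothesis h1_gt0 : forall n, 0 < h1 n.
Hypothesis h1_rate : ln (h1 n) / n%:R @[n --> \oo] --> - a.
Hypothesis h2_gt0 : forall n, 0 < h2 n.
Hypothesis h2_rate : ln (h2 n) / n%:R @[n --> \oo] --> - a.
Hypothesis p_le_m : forall x N n r, 0 < r -> h1 (N + n)%N <= r -> p x N <= Q n * m x r.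
Hypothesis m_le_p : forall q, 1 < q -> exists2 C, 0 < C &
  forall x n r, 0 < r -> r <= h2 n -> m x r <= C * q ^+ n * p x n.
Hypothesis Q_rate : \forall n \near \oo, Q n <= expR (s' * (n%:R * a)).

(* With X = - ln rho, Y = - ln r, the levels M, k of rho and r satisfy M a ~ X
   and k a ~ Y up to a factor 1 +- eta, and Y >= (1 + delta) X. *)
Lemma scale_exponent_le eta kappa X Y xM xk :
  0 < eta -> eta <= 2^-1 -> 0 <= kappa ->
  (4 * eta * s' + 2 * kappa) * (1 + delta) <= delta * (s - s') ->
  0 <= X -> (1 + delta) * X <= Y -> 0 <= xM -> 0 <= xk ->
  (1 - eta) * xM <= X -> X <= (1 + eta) * xM -> (1 - eta) * xk <= Y ->
  kappa * xM + s' * (xk - xM) <= s * (Y - X).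
Proof.
move: (delta0) (s'0) => d0 sp0 e0 e2 k0 ek X0 XY M0 k0' MX XM kY.
have Y0 : 0 <= Y by rewrite (le_trans _ XY)// mulr_ge0//; lra.
have XleY : X <= Y by rewrite (le_trans _ XY)// ler_peMl//; lra.
have etaM : eta * xM <= 2^-1 * xM by rewrite ler_wpM2r.
have etak : eta * xk <= 2^-1 * xk by rewrite ler_wpM2r.
have M2 : xM <= 2 * X by lra.
have k2 : xk <= 2 * Y by lra.
have eM2 : eta * xM <= eta * (2 * Y) by rewrite ler_pM2l//; lra.
have ek2 : eta * xk <= eta * (2 * Y) by rewrite ler_pM2l.
have dif : xk - xM <= Y - X + 4 * eta * Y by lra.
have bd1 : s' * (xk - xM) <= s' * (Y - X + 4 * eta * Y) by rewrite ler_wpM2l.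
have bd2 : kappa * xM <= kappa * (2 * Y) by rewrite ler_wpM2l//; lra.
(* The gap [r <= rho ^ (1 + delta)] keeps [Y - X] above a fixed fraction of [Y], so errors
   proportional to [Y] are absorbed by the slack [s - s']. *)
have dY : delta * Y <= (1 + delta) * (Y - X) by lra.
suff : (4 * eta * s' + 2 * kappa) * Y <= (s - s') * (Y - X) by lra.
rewrite -(ler_pM2l d0).
have c0 : 0 <= 4 * eta * s' + 2 * kappa by rewrite addr_ge0// !mulr_ge0//; lra.
rewrite [leLHS]mulrCA (le_trans (ler_wpM2l c0 dY))// !mulrA ler_wpM2r// subr_ge0//.
Qed.

(** With levels [M] for [rho] and [k] for [r], the chain is [m x rho <= C * q ^+ M * p x M] and
    [p x M <= Q (k - M) * m x r]; [scale_exponent_le] then bounds [q ^+ M * Q (k - M)] by a power of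
    [rho / r]. *)
Lemma quasi_assouad_bound : exists C1 C2 : R, [/\ 0 < C1, 0 < C2 &
  forall x r rho, 0 < r -> 0 < rho -> r <= rho `^ (1 + delta) -> rho <= C1 ->
    m x rho <= C2 * (rho / r) `^ s * m x r].
Proof.
have [n0 _ Qn0] := Q_rate.
move: (a0) (delta0) (s'0) (s's) => a0' d0 sp0 ss.
(* [kappa] and the last entry of [eta] each use at most half of [delta * (s - s')] in [ek]. The
   middle entry of [eta] gives [k >= (1 + delta / 2) * M]. *)
pose kappa := delta * (s - s') / (4 * (1 + delta)).
pose eta := Num.min (2^-1) (Num.min (delta / (4 + 3 * delta)) (delta * (s - s') / (8 * ((s' + 1) * (1 + delta))))).
have ds : 0 < delta * (s - s') by rewrite mulr_gt0// subr_gt0.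
have d1 : 0 < 1 + delta by lra.
have s1 : 0 < s' + 1 by lra.
have d43 : 0 < 4 + 3 * delta by lra.
have kappa0 : 0 < kappa by rewrite divr_gt0// mulr_gt0.
have eta0 : 0 < eta by rewrite !lt_min invr_gt0 ltr0n !divr_gt0// !mulr_gt0.
have eta2 : eta <= 2^-1 by rewrite ge_min lexx.
have eta3 : eta * (4 + 3 * delta) <= delta.
  by rewrite -ler_pdivlMr// !ge_min lexx !orbT.
have eta4 : eta * (8 * ((s' + 1) * (1 + delta))) <= delta * (s - s').
  by rewrite -ler_pdivlMr ?mulr_gt0// !ge_min lexx !orbT.
have kE : kappa * (4 * (1 + delta)) = delta * (s - s') by rewrite divfK// gt_eqF// mulr_gt0.
clearbody eta kappa.
have eta1 : eta <= 1 by lra.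
have ek : (4 * eta * s' + 2 * kappa) * (1 + delta) <= delta * (s - s').
  have : 0 <= eta * (1 + delta) by apply: mulr_ge0; exact: ltW.
  lra.
have [|C C0 hC] := m_le_p (q := expR (a * kappa)); first by rewrite expR_gt1 mulr_gt0.
(* From [M >= K] follows [M * delta / 2 > n0], hence [k - M >= n0] and the growth bound on [Q]
   applies. *)
have [K hK] := lt_natr_bound (2 * n0%:R / delta).
have [b2 b20 hb2] := scale_index a0 h2_gt0 h2_rate K eta0 eta1.
have [b1 b10 hb1] := scale_index a0 h1_gt0 h1_rate 0%N eta0 eta1.
pose c := Num.min (Num.min b1 b2) 1.
have c0 : 0 < c by rewrite !lt_min b10 b20 ltr01.
exists (c / 2), C; split => [||x r rho r0 rho0 rrho rhoc]; rewrite ?divr_gt0//.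
have : rho < c by rewrite (le_lt_trans rhoc)//; lra.
rewrite !lt_min => /andP[/andP[rhob1 rhob2] rho1].
have X0 : 0 < - ln rho by rewrite oppr_gt0 ln_lt0// rho0.
have XY : (1 + delta) * - ln rho <= - ln r.
  rewrite mulrN lerN2 -ln_powR ler_ln ?posrE ?powR_gt0//.
have rr : r <= rho.
  have dX : 0 <= delta * - ln rho by apply: mulr_ge0; exact: ltW.
  by rewrite -ler_ln ?posrE//; lra.
(* The upper bound on [m x rho] needs [rho <= h2 M]; the lower bound on [m x r] needs [h1 k <= r],
   which holds for the later index [k = k'.+1]. *)
have [M [KM rhoM /andP[M1 M2] _ _]] := hb2 rho rho0 rhob2.
have [k' [_ _ _ rk]] := hb1 r r0 (le_lt_trans rr rhob1).
set k := k'.+1 in rk *; move=> /andP[k1 k2].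
have M0 : 0 <= M%:R * a by rewrite mulr_ge0// ltW.
have k0 : 0 <= k%:R * a by rewrite mulr_ge0// ltW.
have Mn0 : 2 * n0%:R < M%:R * delta by rewrite -ltr_pdivrMr// hK.
have kM : (M%:R + n0%:R) <= k%:R :> R.
  have h3 : (1 + delta) * ((1 - eta) * (M%:R * a)) <= (1 + eta) * (k%:R * a).
    by apply: le_trans k2; apply: le_trans XY; rewrite ler_pM2l.
  have h4 : 0 <= (delta - eta * (4 + 3 * delta)) * (M%:R * a) by rewrite mulr_ge0// subr_ge0.
  have h5 : (1 + eta) * ((1 + delta / 2) * (M%:R * a)) <= (1 + eta) * (k%:R * a) by lra.
  rewrite ler_pM2l ?mulrA ?ler_pM2r// in h5; lra.
have nE : (M + (k - M) = k)%N.
  by rewrite subnKC// -(ler_nat R); apply: le_trans kM; rewrite lerDl.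
have nn0 : (n0 <= k - M)%N.
  rewrite -(leq_add2l M) nE -(ler_nat R) natrD//.
have nR : (k - M)%:R = k%:R - M%:R :> R by rewrite -{2}nE natrD addrC addKr.
have step1 := hC x M rho rho0 rhoM.
have step2 : p x M <= Q (k - M)%N * m x r by apply: p_le_m => //; rewrite nE.
have step3 := Qn0 _ nn0.
apply: (le_trans step1).
rewrite -!mulrA ler_pM2l//.
apply: (@le_trans _ _ (expR (a * kappa) ^+ M * (expR (s' * ((k - M)%:R * a)) * m x r))).
  rewrite ler_pM2l ?exprn_gt0 ?expR_gt0// (le_trans step2)// ler_wpM2r//.
rewrite mulrA ler_wpM2r// -expRM_natl -expRD.
rewrite /powR gt_eqF ?divr_gt0// ler_expR ln_div ?posrE// nR.
have := scale_exponent_le eta0 eta2 (ltW kappa0) ek (ltW X0) XY M0 k0 M1 M2 k1.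
lra.
Qed.

End QuasiAssouad.

Lemma EFin_div_neq0 (R : realFieldType) (u v : R) :
  v != 0 -> (u%:E / v%:E)%E = (u / v)%:E.
Proof. by move=> v0; rewrite inver (negbTE v0) EFinM. Qed.

Lemma limf_esup_le_near (R : realType) (T : choiceType) (X : filteredType T)
    (F : set_system X) (f : X -> \bar R) (l : \bar R) :
  (\forall x \near F, f x <= l)%E -> (limf_esup f F <= l)%E.
Proof.
move=> fl; apply: (@le_trans _ _ (ereal_sup (f @` [set x | (f x <= l)%E]))).
  by apply: ereal_inf_lbound; exists [set x | (f x <= l)%E].
by apply: ge_ereal_sup => _ [x fx <-].
Qed.

Lemma limf_esup_ge_near (R : realType) (T : choiceType) (X : filteredType T)
    (F : set_system X) (f : X -> \bar R) (l : \bar R) : ProperFilter F ->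
  (\forall x \near F, l <= f x)%E -> (l <= limf_esup f F)%E.
Proof.
move=> FF lf; apply: le_ereal_inf_tmp => _ [B FB <-].
have [x [Bx lx]] := filter_ex (filterI FB lf).
by apply: (le_trans lx); apply: ereal_sup_ubound; exists x.
Qed.

Lemma limf_esup_lt_near (R : realType) (T : choiceType) (X : filteredType T)
    (F : set_system X) (f : X -> \bar R) (l : \bar R) : Filter F ->
  (limf_esup f F < l)%E -> (\forall x \near F, f x <= l)%E.
Proof.
move=> FF /ereal_inf_lt[_ [B FB <-] Bl]; apply: filterS FB => x Bx.
by apply: le_trans (ltW Bl); apply: ereal_sup_ubound; exists x.
Qed.

(** * Application to the self-similar measure *)

Section Main.
Context {R : realType} (W : weighted_ifs R) (mu : probability (measurableTypeR R) R).
Variable Delta : R -> nat -> set R.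
Hypothesis W_attractor : is_attractor W `[0, 1].
Hypothesis W_first : smap (W := W) ord0 0 = 0.
Hypothesis W_last : smap (W := W) ord_max 1 = 1.
Hypothesis mu_self_similar : self_similar W mu.
Hypothesis mu_support : msupport mu = `[0, 1]%classic.
Hypothesis mu_comparable : weakly_comparable W.
Hypothesis Delta_choice : net_choice W Delta.

Let a := - ln (lambda W).
Let m (x r : R) := fine (mu (ball x r)).
Let p x n := netP W n (Delta x n).

Lemma neg_ln_lambda_gt0 : 0 < - ln (lambda W).
Proof. by rewrite oppr_gt0 ln_lt0// lambda_gt0 lambda_lt1. Qed.

Lemma scale_rate (c : nat -> R) : (forall n, 0 < c n) ->
  ln (c n) / n%:R @[n --> \oo] --> 0 ->
  ln (c n * lambda W ^+ n) / n%:R @[n --> \oo] --> - a.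
Proof.
move=> c0 ch; rewrite opprK -[ln (lambda W)]add0r.
have : ln (c n) / n%:R + ln (lambda W) @[n --> \oo] --> 0 + ln (lambda W).
  by apply: cvgD => //; exact: cvg_cst.
apply: cvg_trans; apply: near_eq_cvg; near=> n.
rewrite lnM ?posrE ?lambdaX_gt0// lnXn ?lambda_gt0// mulrDl -[ln (lambda W) *+ n]mulr_natr mulfK//.
by rewrite pnatr_eq0 -lt0n; near: n; exact: nbhs_infty_gt.
Unshelve. all: by end_near. Qed.

Lemma const_rate (c : R) : ln c / n%:R @[n --> \oo] --> (0 : R).
Proof.
rewrite -(mulr0 (ln c)); apply: cvgM; first exact: cvg_cst.
apply/(gtr0_cvgV0 (f := fun n : nat => n%:R : R)); last exact: cvgr_idn.
by near=> n; rewrite ltr0n; near: n; exact: nbhs_infty_gt.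
Unshelve. all: by end_near. Qed.

Lemma netball_gt0 x r : 0 <= x <= 1 -> 0 < r -> 0 < m x r.
Proof.
move=> x01 r0; rewrite /m fine_gt0// ltey_eq fin_num_measure ?andbT//; last exact: measurable_ballR.
suff : msupport mu x by apply.
by rewrite mu_support /= in_itv.
Qed.

Lemma ball_mass_le1 x r : m x r <= 1.
Proof.
have mB := @measurable_ballR R x r.
rewrite /m -[leRHS]/(fine 1%E) fine_le ?fin_num_measure//.
exact: probability_le1.
Qed.

Lemma ball_mass_le x r r' : r <= r' -> m x r <= m x r'.
Proof.
move=> rr; have mB := @measurable_ballR R x.
rewrite /m fine_le ?fin_num_measure// le_measure ?inE//.
exact: le_ball.
Qed.

Lemma ball_mass_le_netP (f : nat -> R) q : (forall n, 0 < f n) ->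
  (forall n (u w : seq (letter W)) (z : R), Lambda n u -> Lambda n w -> z = 0 \/ z = 1 ->
          smap_word u z <> smap_word w z ->
          f n * lambda W ^+ n <= `|smap_word u z - smap_word w z|) ->
  1 < q -> exists2 C, 0 < C &
  forall x n r, 0 <= x <= 1 -> 0 < r -> r <= f n / 2 * lambda W ^+ n ->
    m x r <= C * q ^+ n * p x n.
Proof.
move=> f0 fsep q1; have q0 : 0 < q by rewrite (lt_trans _ q1).
(* [ball_le_netP] squares the comparability constant, so it is applied with the square root of [q];
   [c'] makes that constant at least 1. *)
have [|c c0 hc] := mu_comparable (q := Num.sqrt q).
  by rewrite -[ltLHS]sqrtr1 ltr_sqrt.
pose c' := Num.max c 1; have c'1 : 1 <= c' by rewrite le_max lexx orbT.
exists (5 * c' ^+ 2); first by rewrite mulr_gt0// exprn_gt0// (lt_le_trans _ c'1).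
move=> x n r x01 r0 rf.
have [/net_intervalP[y [z [nyz DE]]] Dx] := @Delta_choice x n (ltac:(by rewrite /= in_itv)).
rewrite DE /= in_itv /= in Dx.
have sq1 : 1 <= Num.sqrt q by rewrite -[leLHS]sqrtr1 ler_sqrt// ltW.
have -> : 5 * c' ^+ 2 * q ^+ n = 5 * (c' * Num.sqrt q ^+ n) ^+ 2.
  by rewrite exprMn -exprM mulnC exprM sqr_sqrtr ?mulrA// ltW.
rewrite /p DE; apply: ball_le_netP => //.
- by rewrite -[leLHS]mulr1 ler_pM// exprn_ege1.
- move=> D1 D2 n1 n2 ad; have /andP[_ h] := hc n D1 D2 n1 n2 ad.
  apply: (le_trans h); rewrite ler_wpM2r ?netP_ge0//.
  by rewrite ler_wpM2r ?exprn_ge0 ?sqrtr_ge0// le_max lexx.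
- move=> u w z' uL wL z01 ne; apply: le_trans (fsep _ _ _ _ uL wL z01 ne).
  by rewrite mulrC -ler_pdivlMr// mulrAC.
Qed.

(** The real [t] is one of the ratios defining the supremum, so finiteness of [Qsup] is not
    presupposed. *)
Lemma Qsup_ratio x N n r : 0 <= x <= 1 -> 2 * lambda W ^+ (N + n) <= r ->
  exists2 t : R, (t%:E <= Qsup mu W Delta n)%E & p x N <= t * m x r.
Proof.
move=> x01 hr.
have [/net_intervalP[y [z [nyz DE]]] Dx] := @Delta_choice x N (ltac:(by rewrite /= in_itv)).
have yxz : y <= x <= z by move: Dx; rewrite DE /= in_itv.
have [D Dmin] := min_subnet_exists W_first W_last n nyz yxz; rewrite -DE in Dmin.
have [[nD _ DDx] _] := Dmin.
exists (p x N / netP W (N + n) D).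
  apply: (@le_trans _ _ (Qpt W Delta n x)).
    by apply: ereal_sup_ubound; exists N, D.
  by apply: ereal_sup_ubound; exists x => //; rewrite mu_support /= in_itv.
have P0 := netP_gt0 W_attractor nD.
rewrite mulrAC ler_pdivlMr// ler_wpM2l ?netP_ge0//.
exact: le_trans (netP_le_ball mu_self_similar mu_support nD DDx) (ball_mass_le x hr).
Qed.

Lemma net_interval_sub01 n D : net_interval W n D -> D `<=` `[0, 1].
Proof.
move=> /net_intervalP[y [z [[ny nz _ _] ->]]].
have /andP[y0 _] := net_point_itv01 W_attractor ny.
have /andP[_ z1] := net_point_itv01 W_attractor nz.
by move=> t /=; rewrite !in_itv /= => /andP[yt tz]; rewrite (le_trans y0)//= (le_trans tz).
Qed.

Lemma net_interval0 D : net_interval W 0 D -> D = `[0, 1]%classic.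
Proof. by move=> /net_intervalP[y [z [/net_pair_level0[-> ->] ->]]]. Qed.

(** The lower bound comes from the ratio at [N = 0], where the numerator is 1; the upper one is
    [netP_le_subnet]. *)
Lemma Qsup_bounds : exists2 C : R, 1 <= C & forall n,
  (1 <= Qsup mu W Delta n <= (C ^+ n.+1)%:E)%E.
Proof.
have [C C1 hC] := netP_le_subnet W_attractor; exists C => // n; apply/andP; split.
  have x01 : `[0, 1]%classic (0 : R) by rewrite /= in_itv /= lexx ler01.
  have [nD0 D0] := @Delta_choice 0 0 x01.
  have [/net_intervalP[y [z [nyz DE]]] _] := @Delta_choice 0 0 x01.
  have yxz : y <= 0 <= z by move: D0; rewrite DE /= in_itv.
  have [D Dmin] := min_subnet_exists W_first W_last n nyz yxz; rewrite -DE in Dmin.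
  have [[nD _ _] _] := Dmin.
  apply: (@le_trans _ _ (netP W 0 (Delta 0 0) / netP W (0 + n) D)%:E).
    by rewrite lee_fin (netP_level0 nD0) ler_pdivlMr ?mul1r ?netP_le1// (netP_gt0 W_attractor).
  apply: (@le_trans _ _ (Qpt W Delta n 0)).
    by apply: ereal_sup_ubound; exists 0%N, D.
  by apply: ereal_sup_ubound; exists 0 => //; rewrite mu_support.
apply: ge_ereal_sup => _ [x xs <-]; rewrite mu_support in xs; 
apply: ge_ereal_sup => _ [N [D [[[nD DD _] _] ->]]].
rewrite lee_fin ler_pdivrMr ?(netP_gt0 W_attractor)//.
by apply: hC => //; case: (@Delta_choice x N xs).
Qed.

Lemma netP_rate_bound : exists2 M : R, 0 <= M & forall x n, 0 <= x <= 1 -> (0 < n)%N ->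
  - ln (p x n) <= M * (n%:R * a).
Proof.
have [C C1 hC] := netP_le_subnet W_attractor; have C0 : 0 < C := lt_le_trans ltr01 C1.
have a0 : 0 < a := neg_ln_lambda_gt0.
have lC : 0 <= ln C by rewrite ln_ge0.
(* The factor 2 absorbs [n.+1 <= 2 * n], valid as [n > 0]. *)
exists (2 * ln C / a); first by rewrite divr_ge0 ?mulr_ge0// ltW.
move=> x n x01 n0.
have x01' : `[0, 1]%classic x by rewrite /= in_itv.
have [nD0 _] := @Delta_choice x 0 x01'; have [nD _] := @Delta_choice x n x01'.
have := hC 0%N n _ _ nD0 nD; rewrite (netP_level0 nD0) (net_interval0 nD0).
move=> /(_ (net_interval_sub01 nD)); rewrite -/(p x n) => h.
have p0 : 0 < p x n by rewrite /p netP_gt0.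
have : 0 <= ln (C ^+ n.+1 * p x n) by rewrite ln_ge0.
rewrite lnM ?posrE ?exprn_gt0// lnXn// -[ln C *+ _]mulr_natr => h'.
have -> : 2 * ln C / a * (n%:R * a) = 2 * ln C * n%:R.
  by rewrite mulrCA divfK ?gt_eqF// mulrC.
have n1 : n.+1%:R <= 2 * n%:R :> R by rewrite -natrM ler_nat; lia.
have : ln C * n.+1%:R <= ln C * (2 * n%:R) by rewrite ler_wpM2l.
lra.
Qed.

Let h1 n := 2 * lambda W ^+ n.

Lemma h1_rate : ln (h1 n) / n%:R @[n --> \oo] --> - a.
Proof. by apply: scale_rate => // ; exact: const_rate. Qed.

Lemma rate_half (f : nat -> R) : (forall n, 0 < f n) ->
  ln (f n) / n%:R @[n --> \oo] --> 0 ->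
  ln (f n / 2 * lambda W ^+ n) / n%:R @[n --> \oo] --> - a.
Proof.
move=> f0 fr; apply: scale_rate => [n|]; first by rewrite divr_gt0.
rewrite -[X in _ --> X]subr0.
have : ln (f n) / n%:R - ln 2 / n%:R @[n --> \oo] --> (0 - 0 : R).
  by apply: cvgB => //; exact: const_rate.
apply: cvg_trans; apply: near_eq_cvg; apply: nearW => n.
by rewrite ln_div ?posrE// mulrBl.
Qed.

Let U n : \bar R := ((- lne (Qsup mu W Delta n)) / (n%:R * ln (lambda W))%:E)%E.
Let Q n := fine (Qsup mu W Delta n).

Lemma Qsup_fine n : Qsup mu W Delta n = (Q n)%:E.
Proof.
have [C C1 /(_ n)/andP[q1 qC]] := Qsup_bounds.
rewrite /Q fineK// fin_numE; apply/andP; split.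
  by rewrite gt_eqF// (lt_le_trans _ q1)// ltNye.
by rewrite lt_eqF// (le_lt_trans qC)// ltey.
Qed.

Lemma Q_ge1 n : 1 <= Q n.
Proof. by have [C C1 /(_ n)/andP[q1 _]] := Qsup_bounds; rewrite Qsup_fine lee_fin in q1. Qed.

Lemma Q_exponentE n : (0 < n)%N -> U n = (ln (Q n) / (n%:R * a))%:E.
Proof.
move=> n0; have a0 : 0 < a := neg_ln_lambda_gt0.
have q0 : 0 < Q n := lt_le_trans ltr01 (Q_ge1 n).
have na : n%:R * a != 0 by rewrite mulf_neq0 ?gt_eqF// ltr0n.
rewrite /U Qsup_fine lne_EFin// -EFinN EFin_div_neq0.
  by rewrite /a mulrN invrN mulrN mulNr.
by rewrite -oppr_eq0 -mulrN.
Qed.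

(** Both bounds follow from [Qsup_bounds]. Nonnegativity of [l] supplies the sign condition on [s']
    in [quasi_assouad_bound]. *)
Lemma Q_exponent_bounds : exists l : R, 0 <= l /\ limn_esup U = l%:E.
Proof.
have [C C1 hC] := Qsup_bounds; have C0 : 0 < C := lt_le_trans ltr01 C1.
have a0 : 0 < a := neg_ln_lambda_gt0.
have U0 : (0 <= limn_esup U)%E.
  apply: limf_esup_ge_near; near=> n; rewrite Q_exponentE; last by near: n; exact: nbhs_infty_gt.
  by rewrite lee_fin divr_ge0 ?ln_ge0 ?Q_ge1// mulr_ge0// ltW.
have UC : (limn_esup U <= (2 * ln C / a)%:E)%E.
  apply: limf_esup_le_near; near=> n.
  have n0 : (0 < n)%N by near: n; exact: nbhs_infty_gt.
  rewrite Q_exponentE// lee_fin ler_pdivrMr ?mulr_gt0 ?ltr0n//.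
  have -> : 2 * ln C / a * (n%:R * a) = 2 * ln C * n%:R.
    by rewrite mulrCA divfK ?gt_eqF// mulrC.
  have /andP[_] := hC n; rewrite Qsup_fine lee_fin => QC.
  have lQ : ln (Q n) <= ln (C ^+ n.+1).
    by rewrite ler_ln ?posrE ?exprn_gt0// (lt_le_trans ltr01 (Q_ge1 n)).
  rewrite lnXn// -[ln C *+ _]mulr_natr in lQ.
  have n1 : n.+1%:R <= 2 * n%:R :> R by rewrite -natrM ler_nat; lia.
  have lC : 0 <= ln C by rewrite ln_ge0.
  have : ln C * n.+1%:R <= ln C * (2 * n%:R) by rewrite ler_wpM2l.
  lra.
exists (fine (limn_esup U)); rewrite fineK; first by rewrite fine_ge0.
by rewrite ge0_fin_numE// (le_lt_trans UC)// ltey.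
Unshelve. all: by end_near. Qed.

Lemma quasi_assouad_le : AGWSC W -> (dim_qA mu <= limn_esup U)%E.
Proof.
move=> [f [_ f0 fr fsep]].
have a0 : 0 < a := neg_ln_lambda_gt0.
have [l [l0 lE]] := Q_exponent_bounds; rewrite lE.
apply: lime_le; first exact: qA_exponent_cvg.
near=> delta; have delta0 : 0 < delta by near: delta; exact: nbhs_right_gt.
apply/lee_addgt0Pr => e e0; rewrite -EFinD; apply: ereal_inf_lbound; exists (l + e) => //.
(* Indexing by the points of the support makes the constants uniform in [x]. [Q] grows at rate at
   most [l + e / 2], leaving slack [e / 2] below the exponent [l + e]. *)
pose T := {x : R | 0 <= x <= 1}.
have Qrate : \forall n \near \oo, Q n <= expR ((l + e / 2) * (n%:R * a)).
  have : (limn_esup U < (l + e / 2)%:E)%E by rewrite lE lte_fin; lra.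
  move=> /limf_esup_lt_near H; near=> n.
  have n0 : (0 < n)%N by near: n; exact: nbhs_infty_gt.
  have : (U n <= (l + e / 2)%:E)%E by near: n; exact: H.
  rewrite Q_exponentE// lee_fin ler_pdivrMr ?mulr_gt0 ?ltr0n// => h.
  by rewrite -[leLHS]lnK ?posrE ?(lt_le_trans ltr01 (Q_ge1 n))// ler_expR.
have [||||||||||||C1 [C2 [C10 C20 hC]]] := @quasi_assouad_bound R T a delta (l + e) (l + e / 2)
   (fun x n => p (sval x) n) Q h1 (fun n => f n / 2 * lambda W ^+ n) (fun x r => m (sval x) r).
- exact: a0.
- exact: delta0.
- lra.
- lra.
- by move=> x r; rewrite fine_ge0.
- by move=> n; rewrite mulr_gt0 ?lambdaX_gt0.
- exact: h1_rate.
- by move=> n; rewrite mulr_gt0 ?lambdaX_gt0// divr_gt0.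
- exact: rate_half.
- move=> [x x01] N n r r0 hr /=; have [t tQ pt] := Qsup_ratio x01 hr.
  apply: (le_trans pt); rewrite ler_wpM2r ?fine_ge0//.
  by rewrite Qsup_fine lee_fin in tQ.
- move=> q q1; have [C C0 hC] := ball_mass_le_netP f0 fsep q1; exists C => //.
  by move=> [x x01] n r r0 hr; exact: hC.
- exact: Qrate.
exists C1, C2; split => // r rho r0 rrho rho1 rhoC.
apply: ge_ereal_sup => _ [x xs <-]; rewrite mu_support /= in_itv /= in xs.
have mB := @measurable_ballR R x.
have rho0 : 0 < rho by rewrite (lt_le_trans r0)// (le_trans rrho).
have mr := netball_gt0 xs r0.
rewrite -(fineK (fin_num_measure mu _ (mB rho))) -(fineK (fin_num_measure mu _ (mB r))).
rewrite EFin_div_neq0 ?gt_eqF// lee_fin ler_pdivrMr//.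
exact: (hC (exist _ x xs)).
Unshelve. all: by end_near. Qed.

Lemma local_dimension_netP x : AGWSC W -> 0 <= x <= 1 ->
  upper_dim_loc mu x = limn_esup (fun n => (ln (p x n) / (n%:R * ln (lambda W)))%:E) /\
  lower_dim_loc mu x = limn_einf (fun n => (ln (p x n) / (n%:R * ln (lambda W)))%:E).
Proof.
move=> [f [_ f0 fr fsep]] x01.
have a0 : 0 < a := neg_ln_lambda_gt0.
have x01' : `[0, 1]%classic x by rewrite /= in_itv.
have [M M0 hM] := netP_rate_bound.
have p0 n : 0 < p x n by apply: (netP_gt0 W_attractor); case: (@Delta_choice x n x01').
have -> : ln (lambda W) = - a by rewrite opprK.
apply: (@local_dimension_eq R a M (p x) h1 (fun n => f n / 2 * lambda W ^+ n) (m x)) => //.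
- by move=> n; exact: netP_le1.
- by move=> r r0; exact: netball_gt0.
- by move=> r; exact: ball_mass_le1.
- by move=> n; exact: hM.
- by move=> n; rewrite mulr_gt0 ?lambdaX_gt0.
- exact: h1_rate.
- by move=> n; rewrite mulr_gt0 ?lambdaX_gt0// divr_gt0.
- exact: rate_half.
- move=> n r r0 hr; have [nD Dx] := @Delta_choice x n x01'.
  exact: le_trans (netP_le_ball mu_self_similar mu_support nD Dx) (ball_mass_le x hr).
- move=> q q1; have [C C0 hC] := ball_mass_le_netP f0 fsep q1; exists C => //.
  by move=> n r r0 hr; exact: hC.
- move=> r r0 r1.
  rewrite -(fineK (fin_num_measure mu _ (measurable_ballR x r))).
  by rewrite lne_EFin ?netball_gt0// EFin_div_neq0// lt_eqF// ln_lt0// r0.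
Qed.

End Main.

Theorem theorem5p12 (R : realType) (W : weighted_ifs R)
    (mu : probability (measurableTypeR R) R)
    (Delta : R -> nat -> set R)
    (W_attractor : is_attractor W `[0, 1])
    (W_first : smap (W := W) ord0 0 = 0)
    (W_last : smap (W := W) ord_max 1 = 1)
    (mu_self_similar : self_similar W mu)
    (mu_support : msupport mu = `[0, 1]%classic)
    (mu_comparable : weakly_comparable W)
    (W_agwsc : AGWSC W)
    (Delta_choice : net_choice W Delta) :
  [/\ (dim_qA mu <=
         limn_esup (fun n => (- lne (Qsup mu W Delta n)) / (n%:R * ln (lambda W))%:E))%E,
      (limn_esup (fun n => (- lne (Qsup mu W Delta n)) / (n%:R * ln (lambda W))%:E)
         < +oo)%E &
      forall x : R, `[0, 1]%classic x ->
        upper_dim_loc mu x =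
          limn_esup (fun n => (ln (netP W n (Delta x n)) / (n%:R * ln (lambda W)))%:E) /\
        lower_dim_loc mu x =
          limn_einf (fun n => (ln (netP W n (Delta x n)) / (n%:R * ln (lambda W)))%:E)].
Proof.
split.
- exact: quasi_assouad_le.
- have [l [_ ->]] := Q_exponent_bounds W_attractor W_first W_last mu_support Delta_choice.
  exact: ltey.
- move=> x; rewrite /= in_itv /= => x01; exact: local_dimension_netP.
Qed.
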